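(* Let $K$ be a field of characteristic $p>0$ and let $a\in K^{{\mathbb N}}$ be a nonzero simple nondegenerate $K$-recurrence sequence of order $d$. Then ${\mathcal Z}(a)=\{n\in{\mathbb N}\mid a(n)=0\}$ is a $p$-nested set of order $\le d-2$.
   Context: ${\mathbb N}=\{0,1,2,\dots\}$. Let $E$ be the shift operator $(Ea)(n)=a(n+1)$, making $K^{{\mathbb N}}$ a $K[E]$-module. For a $K$-recurrence sequence $a$ (one with $P(E)a=0$ for some nonzero $P$), the ideal $\{P\in K[E]\mid P(E)a=0\}$ is generated by a unique monic polynomial $P_a$, the minimum polynomial; its degree is the order of $a$. $a$ is simple if all roots of $P_a$ (in an algebraic closure) are distinct, and nondegenerate if all roots of $P_a$ are nonzero and the quotient of any two distinct roots is not a root of unity. Let $q$ be a power of $p$. For $r\ge1$ and $c_0,\dots,c_r\in{\mathbb Q}$ with $(q-1)c_i\in{\mathbb Z}$, $c_0+\cdots+c_r\in{\mathbb Z}$, $c_i\neq0$ for $1\le i\le r$ and $c_i>0$ for some $1\le i\le r$, the set $S_q(c_0;c_1,\dots,c_r)=\{c_0+\sum_{i=1}^rc_iq^{k_i}\mid k_1,\dots,k_r\in{\mathbb N}\}\cap{\mathbb N}$ is an elementary $p$-nested set of order $r$. A $p$-nested set of order $\le k$ is the union of a finite set and finitely many elementary $p$-nested sets (possibly for different powers $q$ of $p$) of orders $\le k$; for $k\le0$ it is just a finite set. *)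

(* Defs.v *)
From HB Require Import structures.
From mathcomp Require Import all_boot all_order all_algebra.
Set Implicit Arguments. Unset Strict Implicit. Unset Printing Implicit Defensive.
Import Order.TTheory GRing.Theory Num.Theory.
Local Open Scope ring_scope.

Definition annihilates (K : fieldType) (P : {poly K}) (a : nat -> K) : Prop :=
  forall n : nat, \sum_(i < size P) P`_i * a (n + i)%N = 0.

Definition recurrence_seq (K : fieldType) (a : nat -> K) : Prop :=
  exists2 P : {poly K}, P != 0 & annihilates P a.

Definition is_minpoly (K : fieldType) (a : nat -> K) (P : {poly K}) : Prop :=
  [/\ P \is monic, annihilates P a & forall Q : {poly K}, annihilates Q a -> P %| Q].

(* Roots "in an algebraic closure" are rendered as roots in any field
   extension L of K (given by a ring morphism f : K -> L). *)
Definition simple_poly (K : fieldType) (P : {poly K}) : Prop :=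
  forall (L : fieldType) (f : {rmorphism K -> L}) (x : L),
    ~~ ((('X - x%:P) ^+ 2) %| map_poly f P).

Definition is_root_of_unity (L : fieldType) (z : L) : Prop :=
  exists2 n : nat, (0 < n)%N & z ^+ n = 1.

Definition nondegenerate_poly (K : fieldType) (P : {poly K}) : Prop :=
  forall (L : fieldType) (f : {rmorphism K -> L}) (x y : L),
    root (map_poly f P) x -> root (map_poly f P) y ->
    x != 0 /\ (x != y -> ~ is_root_of_unity (x / y)).

Definition simple_seq (K : fieldType) (a : nat -> K) : Prop :=
  exists2 P, is_minpoly a P & simple_poly P.
Definition nondegenerate_seq (K : fieldType) (a : nat -> K) : Prop :=
  exists2 P, is_minpoly a P & nondegenerate_poly P.

(* Data of an elementary p-nested set S_q(c_0; c_1,...,c_r), r = size cs. *)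
Record elem_data := ElemData { ed_q : nat; ed_c0 : rat; ed_cs : seq rat }.

Definition ed0 : elem_data := ElemData 0 0 [::].

Definition is_int (x : rat) : Prop := exists z : int, x = z%:~R.

Definition elem_valid (p : nat) (e : elem_data) : Prop :=
  let q := ed_q e in let c0 := ed_c0 e in let cs := ed_cs e in
  [/\ (exists2 k : nat, (0 < k)%N & q = (p ^ k)%N),
      (1 <= size cs)%N,
      is_int ((q.-1)%:R * c0) /\ (forall i : nat, (i < size cs)%N -> is_int ((q.-1)%:R * cs`_i)),
      is_int (c0 + \sum_(i < size cs) cs`_i)
    & (forall i : nat, (i < size cs)%N -> cs`_i != 0) /\
      (exists2 i : nat, (i < size cs)%N & 0 < cs`_i)].

Definition elem_mem (e : elem_data) (n : nat) : Prop :=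
  exists2 ks : seq nat, size ks = size (ed_cs e) &
    (n%:R : rat) = ed_c0 e + \sum_(i < size (ed_cs e)) (ed_cs e)`_i * ((ed_q e ^ nth 0%N ks i)%N)%:R.

(* S is a p-nested set of order <= k: union of a finite set and finitely many
   elementary p-nested sets of orders in [1, k]. For k = 0 it is finite. *)
Definition p_nested (p k : nat) (S : nat -> Prop) : Prop :=
  exists (F : seq nat) (E : seq elem_data),
    (forall j : nat, (j < size E)%N ->
        elem_valid p (nth ed0 E j) /\ (size (ed_cs (nth ed0 E j)) <= k)%N) /\
    (forall n : nat, S n <-> (n \in F \/ exists2 j : nat, (j < size E)%N & elem_mem (nth ed0 E j) n)).

Definition zero_set (K : fieldType) (a : nat -> K) : nat -> Prop :=
  fun n => a n = 0.

(* Main.v *)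
(**
The zeros of [a] are the [n] with [sum_i gamma_i alpha_i^n = 0], that is, with the point
[alpha^n = (alpha_1^n, ..., alpha_d^n)] on a hyperplane.  More generally let [W] be a proper
subspace of [L^d]; the set [Z_W] of all integers [n] with [alpha^n] in [W] is a finite union of
elementary sets of order [< dim W], by induction on [dim W].

For [0 <= r < p] the [m] with [p m + r] in [Z_W] form [Z_W'], where [W'] is the inverse image under
Frobenius of [alpha^(-r) W], so [dim W' <= dim W].  After replacing [alpha], [gamma] by p-power
powers, they lie in a finitely generated field that is a finite separable extension of a rational
function field; it has a finite p-basis, and the p-th roots of the coordinates of the equations of
the [W'] stay in a finite set (degrees are divided by [p]).  So only finitely many spaces occur.

If at some level [p^N] all dimensions have dropped, [Z_W] is a finite union of affine images of
smaller cases.  Otherwise the same space occurs at two levels, so that the image of [W] under the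
f-th power of Frobenius spans [alpha^(-u) W]; hence [Z_W] is stable under [n |-> q n + u]
([q = p^f]) and its inverse.  As [alpha^x W = W] only for [x = 0] (Vandermonde), a second use of
the pigeonhole principle shows that the dimension drops on all residues modulo some [q^k] which are
not congruent to [u] modulo [q].  Every [n] in [Z_W] is the fixed point of [n |-> q n + u] or is an
iterate of a point in such a residue class.  This yields the elementary sets, with their exponents
bounded below by the first one; a Krylov space argument removes that constraint.
*)
Require Import Defs.
From HB Require Import structures.
From mathcomp Require Import all_boot all_order all_algebra all_field.
From mathcomp Require Import boolp ring zify.
Import Order.TTheory GRing.Theory Num.Theory.
Set Implicit Arguments. Unset Strict Implicit. Unset Printing Implicit Defensive.
Local Open Scope ring_scope.

(** * Finite unions of elementary sets of integers *)

Definition elem_val (q : nat) (e : rat * seq rat) (ks : nat -> nat) : rat :=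
  e.1 + \sum_(i < size e.2) e.2`_i * (q ^ ks i)%:R.

Definition elem_set (q : nat) (e : rat * seq rat) (n : int) : Prop :=
  exists ks : nat -> nat, n%:~R = elem_val q e ks.

(** Only integrality is recorded, which makes the class stable under every integer affine map, also
    with zero or negative factor; signs and zero coefficients are dealt with in
    [nested_p_nested]. *)
Definition elem_ok (q : nat) (e : rat * seq rat) : Prop :=
  [/\ q.-1%:R * e.1 \is a Num.int,
      forall i, (i < size e.2)%N -> q.-1%:R * e.2`_i \is a Num.int
    & e.1 + \sum_(i < size e.2) e.2`_i \is a Num.int].

(** The strict bound [w] stands for a dimension. An empty coefficient list gives a singleton, so
    finite sets are covered once [w] is positive. *)
Definition nested (q w : nat) (Z : int -> Prop) : Prop :=
  exists E : seq (rat * seq rat),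
    (forall e, e \in E -> elem_ok q e /\ (size e.2 < w)%N) /\
    (forall n, Z n <-> exists2 e, e \in E & elem_set q e n).

Lemma nested_ext q w (Z Z' : int -> Prop) :
  (forall n, Z n <-> Z' n) -> nested q w Z -> nested q w Z'.
Proof.
by move=> ZZ' [E [h1 h2]]; exists E; split=> // n; rewrite -ZZ'.
Qed.

Lemma nested_le q w w' Z : (w <= w')%N -> nested q w Z -> nested q w' Z.
Proof.
move=> ww' [E [h1 h2]]; exists E; split=> // e /h1[? lt]; split=> //.
exact: leq_trans lt ww'.
Qed.

Lemma nested0 q w Z : (forall n, ~ Z n) -> nested q w Z.
Proof. by move=> Z0; exists [::]; split=> // n; split=> [/Z0//|[]]. Qed.

Lemma nestedU q w Z Z' : nested q w Z -> nested q w Z' ->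
  nested q w (fun n => Z n \/ Z' n).
Proof.
move=> [E [h1 h2]] [E' [h1' h2']]; exists (E ++ E'); split.
  by move=> e; rewrite mem_cat => /orP[/h1|/h1'].
move=> n; rewrite h2 h2'; split.
  by case=> -[e eE en]; exists e; rewrite // mem_cat eE ?orbT.
by case=> e; rewrite mem_cat => /orP[eE|eE] en; [left|right]; exists e.
Qed.

Lemma nested_bigU q w (I : eqType) (s : seq I) (Z : I -> int -> Prop) :
  (forall i, i \in s -> nested q w (Z i)) ->
  nested q w (fun n => exists2 i, i \in s & Z i n).
Proof.
elim: s => [|i s IH] hs; first by apply: nested0 => n [].
apply: (@nested_ext _ _ (fun n => Z i n \/ exists2 j, j \in s & Z j n)).
  move=> n; split=> [[Zi|[j js Zj]]|[j]].
  - by exists i; rewrite // inE eqxx.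
  - by exists j; rewrite // inE js orbT.
  - by rewrite inE => /orP[/eqP->|js Zj]; [left|right; exists j].
apply: nestedU; first by apply: hs; rewrite inE eqxx.
by apply: IH => j js; apply: hs; rewrite inE js orbT.
Qed.

Lemma nested1 q w n0 : (0 < w)%N -> nested q w (fun n => n = n0).
Proof.
move=> w0; exists [:: (n0%:~R, [::])]; split.
  move=> e; rewrite inE => /eqP->; split=> //; split=> //=.
    by rewrite rpredM // ?intr_int // natr_int.
  by rewrite big_ord0 addr0 intr_int.
move=> n; split=> [->|[e]].
  by exists (n0%:~R, [::]); rewrite ?inE //; exists id; rewrite /elem_val big_ord0 addr0.
by rewrite inE => /eqP-> [ks]; rewrite /elem_val big_ord0 addr0 => /intr_inj.
Qed.

(** [q - 1] divides [q ^ k - 1], the quotient being a geometric sum. *)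
Lemma mul_expn_sub1_int (q k : nat) (c : rat) : (0 < q)%N ->
  q.-1%:R * c \is a Num.int -> c * ((q ^ k)%:R - 1) \is a Num.int.
Proof.
case: q => // q _ qc; have -> : c * ((q.+1 ^ k)%:R - 1) = q%:R * c * \sum_(i < k) q.+1%:R ^+ i.
  by rewrite natrX subrX1 -[q.+1]addn1 natrD addrK mulrCA mulrA.
by apply: rpredM => //; apply: rpred_sum => i _; rewrite -natrX natr_int.
Qed.

(** With all exponents 0 the value is integral by the last clause of [elem_ok], and raising an
    exponent from 0 changes it by an integer. *)
Lemma elem_val_int q e ks : (0 < q)%N -> elem_ok q e -> elem_val q e ks \is a Num.int.
Proof.
move=> q0 [e1 e2 e3].
have -> : elem_val q e ks = (e.1 + \sum_(i < size e.2) e.2`_i) +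
     \sum_(i < size e.2) e.2`_i * ((q ^ ks i)%:R - 1).
  rewrite -addrA -big_split /=; congr (_ + _); apply: eq_bigr => i _.
  by rewrite mulrBr mulr1 addrC subrK.
apply: rpredD => //; apply: rpred_sum => i _.
by apply: mul_expn_sub1_int => //; apply: e2.
Qed.

Lemma nested_affine q w (Z : int -> Prop) (a b : int) : (0 < q)%N -> nested q w Z ->
  nested q w (fun n => exists2 m, Z m & n = a * m + b).
Proof.
move=> q0 [E [h1 h2]].
pose f (e : rat * seq rat) := (a%:~R * e.1 + b%:~R, [seq a%:~R * c | c <- e.2]) : rat * seq rat.
have fval e ks : elem_val q (f e) ks = a%:~R * elem_val q e ks + b%:~R.
  rewrite /elem_val /= size_map mulrDr mulr_sumr -!addrA; congr (_ + _).
  rewrite addrC; congr (_ + _).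
  by apply: eq_bigr => i _; rewrite (nth_map 0) // mulrA.
exists [seq f e | e <- E]; split.
  move=> _ /mapP[e eE ->]; have [[e1 e2 e3] sz] := h1 _ eE.
  split; last by rewrite size_map.
  split=> /=.
  - rewrite mulrDr mulrCA; apply: rpredD; apply: rpredM => //;
      by rewrite ?intr_int ?natr_int.
  - move=> i; rewrite size_map => ilt; rewrite (nth_map 0) // mulrCA.
    by apply: rpredM; [rewrite intr_int | apply: e2].
  - rewrite size_map; under eq_bigr => i _ do rewrite (nth_map 0) //.
    rewrite -mulr_sumr addrAC -mulrDr.
    by apply: rpredD; [apply: rpredM|]; rewrite ?intr_int.
move=> n; split=> [[m /h2[e eE [ks mE]] ->]|[_ /mapP[e eE ->] [ks]]].
  by exists (f e); [apply: map_f | exists ks; rewrite fval -mE -intrM -intrD].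
rewrite fval => nE; have [[e1 e2 e3] _] := h1 _ eE.
(* The preimage is a priori only the rational [elem_val q e ks]. *)
have /intrP[m mE] := elem_val_int ks q0 (h1 _ eE).1.
exists m; first by apply/h2; exists e => //; exists ks.
by apply: (@intr_inj rat); rewrite nE mE intrD intrM.
Qed.

(** Each exponent is divided by [g] with remainder; the finitely many choices of remainders [l] are
    absorbed into the coefficients. *)
Lemma nested_refine q g w (Z : int -> Prop) : (0 < q)%N -> (0 < g)%N ->
  nested q w Z -> nested (q ^ g) w Z.
Proof.
move=> q0 g0 [E [h1 h2]].
pose ext k (l : {ffun 'I_k -> 'I_g}) i : nat := if insub i is Some j then l j else 0%N.
have extE k (l : {ffun 'I_k -> 'I_g}) (i : 'I_k) : ext k l i = l i by rewrite /ext valK.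
pose f (e : rat * seq rat) (l : {ffun 'I_(size e.2) -> 'I_g}) :=
  (e.1, mkseq (fun i => e.2`_i * (q ^ ext _ l i)%:R) (size e.2)) : rat * seq rat.
have fval e l ks : elem_val (q ^ g) (f e l) ks =
    elem_val q e (fun i => ext _ l i + g * ks i)%N.
  rewrite /elem_val /= size_mkseq; congr (_ + _); apply: eq_bigr => i _.
  by rewrite nth_mkseq // expnD natrM expnM mulrA.
have fok e l : elem_ok q e -> elem_ok (q ^ g) (f e l).
  move=> ok; have [e1 e2 e3] := ok; split=> /=.
  - rewrite predn_exp natrM mulrAC; apply: rpredM => //; exact: natr_int.
  - move=> i; rewrite size_mkseq => ilt; rewrite nth_mkseq //.
    rewrite predn_exp natrM mulrACA; apply: rpredM; first exact: e2.
    by apply: rpredM; exact: natr_int.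
  - rewrite size_mkseq; under eq_bigr => i _ do rewrite nth_mkseq //.
    exact: (elem_val_int (ext _ l) q0 ok).
exists [seq f e l | e <- E, l <- enum {: {ffun 'I_(size e.2) -> 'I_g}}]; split.
  move=> _ /allpairsPdep[e [l [eE _ ->]]]; have [ok sz] := h1 _ eE.
  by split; [apply: fok | rewrite size_mkseq].
move=> n; rewrite h2; split=> [[e eE [ks nE]]|[_ /allpairsPdep[e [l [eE _ ->]]] [ks]]].
  pose l := [ffun i : 'I_(size e.2) => Ordinal (ltn_pmod (ks i) g0)].
  exists (f e l); first by apply/allpairsPdep; exists e, l; rewrite mem_enum.
  exists (fun i => ks i %/ g)%N; rewrite fval nE /elem_val; congr (_ + _).
  by apply: eq_bigr => i _; rewrite extE ffunE /= addnC mulnC -divn_eq.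
by rewrite fval => nE; exists e => //; eexists; exact: nE.
Qed.

Lemma elem_sum_filter q (cs : seq rat) (x : rat) :
  (exists ks : nat -> nat, x = \sum_(i < size cs) cs`_i * (q ^ ks i)%:R) <->
  (exists ks : nat -> nat, let cs' := [seq c <- cs | c != 0] in
     x = \sum_(i < size cs') cs'`_i * (q ^ ks i)%:R).
Proof.
elim: cs x => [|c cs IH] x //=.
case: (eqVneq c 0) => [-> |c0] /=.
  rewrite -IH; split=> -[ks ->].
    by exists (fun i => ks i.+1); rewrite big_ord_recl mul0r add0r.
  by exists (fun i => ks i.-1); rewrite big_ord_recl mul0r add0r.
split=> -[ks ->].
  have [|ks' /= e] := (IH (\sum_(i < size cs) cs`_i * (q ^ ks i.+1)%:R)).1.
    by exists (fun i => ks i.+1).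
  exists (fun i => if i is j.+1 then ks' j else ks 0%N).
  by rewrite !big_ord_recl /= -e.
have [|ks' /= e] := (IH (\sum_(i < size [seq c <- cs | c != 0])
    [seq c <- cs | c != 0]`_i * (q ^ ks i.+1)%:R)).2.
  by exists (fun i => ks i.+1).
exists (fun i => if i is j.+1 then ks' j else ks 0%N).
by rewrite !big_ord_recl /= -e.
Qed.

(** Without a positive coefficient, all natural members are bounded by the constant term, so these
    data only contribute to the finite part, taken to be all members below [B]. The other data lose
    their zero coefficients. *)
Lemma nested_p_nested p f w (Z : int -> Prop) : (1 < p)%N -> (0 < f)%N ->
  nested (p ^ f) w Z -> p_nested p w.-1 (fun n : nat => Z n).
Proof.
move=> p1 f0 [E [h1 h2]]; set q := (p ^ f)%N in h1 h2.
have q0 : (0 < q)%N by rewrite expn_gt0 (ltnW p1).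
pose nz (e : rat * seq rat) := [seq c <- e.2 | c != 0].
pose pos (e : rat * seq rat) := has (fun c => 0 < c) e.2.
pose B := (\max_(e <- E) (Num.bound `|e.1|))%N.
have fin e (n : nat) : e \in E -> ~~ pos e -> elem_set q e n -> (n < B)%N.
  move=> eE /hasPn npos [ks nE]; apply: leq_trans (leq_bigmax_seq _ eE isT).
  rewrite -(ltr_nat rat); apply: le_lt_trans (archi_boundP (normr_ge0 _)).
  apply: le_trans (ler_norm _); rewrite [n%:R]nE gerDl; apply: sumr_le0 => i _.
  by rewrite mulr_le0_ge0 ?ler0n // leNgt; apply: npos; apply: mem_nth.
pose G := [seq ElemData q e.1 (nz e) | e <- E & pos e].
have nthG j : (j < size G)%N -> exists2 e, nth ed0 G j = ElemData q e.1 (nz e) & pos e && (e \in E).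
  rewrite size_map => jlt; exists (nth (0, [::]) [seq e <- E | pos e] j).
    by rewrite (nth_map (0, [::])).
  by rewrite -mem_filter mem_nth.
exists [seq n <- iota 0 B | `[< Z n%:Z >]], G; split.
  move=> j /nthG[e ->] /andP[/hasP[c ce c0] eE] /=.
  have [[e1 e2 e3] sz] := h1 _ eE; split; last first.
    rewrite /= size_filter; apply: leq_trans (count_size _ _) _.
    by rewrite -ltnS prednK // (leq_ltn_trans _ sz).
  have cn : c \in nz e by rewrite mem_filter gt_eqF.
  split=> /=.
  - by exists f.
  - by move: cn; case: (nz e).
  - split; first exact/intrP.
    move=> i ilt; apply/intrP; have := mem_nth 0 ilt; rewrite mem_filter => /andP[_ ce'].
    by rewrite -(nth_index 0 ce'); apply: e2; rewrite index_mem.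
  - apply/intrP; move: e3; rewrite -(big_mkord xpredT (fun i => e.2`_i)).
    rewrite -(big_mkord xpredT (fun i => (nz e)`_i)) -(big_nth 0 xpredT id) -(big_nth 0 xpredT id).
    rewrite big_filter [in X in _ -> X]big_mkcond /=; congr (_ + _ \is a _).
    by apply: eq_bigr => i _; case: eqP.
  - split; first by move=> i ilt; have := mem_nth 0 ilt; rewrite mem_filter => /andP[].
    by exists (index c (nz e)); rewrite ?index_mem ?nth_index.
have memG e (n : nat) : elem_mem (ElemData q e.1 (nz e)) n <-> elem_set q e n.
  rewrite /elem_set /elem_val.
  have -> : (exists ks : nat -> nat, n%:~R = e.1 + \sum_(i < size e.2) e.2`_i * (q ^ ks i)%:R) <->
    (exists ks : nat -> nat, n%:~R - e.1 = \sum_(i < size e.2) e.2`_i * (q ^ ks i)%:R).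
    by split=> -[ks h]; exists ks; [rewrite h addrC addKr | rewrite -h addrC subrK].
  rewrite elem_sum_filter /= -/(nz e); split=> [[ks sks /= h]|[ks h]].
    by exists (nth 0%N ks); rewrite [n%:~R]h addrC addKr.
  exists (mkseq ks (size (nz e))); rewrite /= ?size_mkseq //.
  under eq_bigr => i _ do rewrite nth_mkseq //.
  by rewrite -h addrC subrK.
move=> n; rewrite h2; split=> [[e eE en]|].
  case: (boolP (pos e)) => pe; last first.
    have zn : Z n by apply: (h2 (Posz n)).2; exists e.
    by left; rewrite mem_filter mem_iota add0n (fin e) // asboolT.
  right; exists (index e [seq e <- E | pos e]).
    by rewrite size_map index_mem mem_filter pe.
  rewrite (nth_map (0, [::])) ?index_mem ?nth_index ?mem_filter ?pe //.
  exact/memG.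
case=> [|[j jlt]].
  by rewrite mem_filter => /andP[/asboolP zn _]; apply: (h2 (Posz n)).1.
have [e -> /andP[pe eE]] := nthG _ jlt.
by move=> /memG; exists e.
Qed.

(** * Frobenius and diagonal actions on subspaces *)

Section Frobenius.
Variables (L : comNzRingType) (p : nat) (charp : p \in [pchar L]).

(** The proof of the characteristic is an argument so that the morphism instances below can be
    attached to [frob charp N]. *)
Definition frob of p \in [pchar L] := fun (N : nat) (x : L) => x ^+ (p ^ N).

Lemma frob_zmod_morphism N : zmod_morphism (frob charp N).
Proof.
have pn : [pchar L].-nat (p ^ N)%N by rewrite pnatX pnatE ?charp ?(pcharf_prime charp).
by move=> x y; rewrite /frob exprDn_pchar // exprNn_pchar.
Qed.

Lemma frob_monoid_morphism N : monoid_morphism (frob charp N).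
Proof. by split=> [|x y]; rewrite /frob ?expr1n ?exprMn. Qed.

HB.instance Definition _ N :=
  GRing.isZmodMorphism.Build L L (frob charp N) (frob_zmod_morphism N).
HB.instance Definition _ N :=
  GRing.isMonoidMorphism.Build L L (frob charp N) (frob_monoid_morphism N).

Lemma frob_comp M N x : frob charp M (frob charp N x) = frob charp (M + N) x.
Proof. by rewrite /frob -exprM mulnC -expnD. Qed.

Lemma map_frob_comp M N m n (A : 'M[L]_(m, n)) :
  map_mx (frob charp M) (map_mx (frob charp N) A) = map_mx (frob charp (M + N)) A.
Proof. by apply/matrixP => i j; rewrite !mxE frob_comp. Qed.

Lemma map_frob0 m n (A : 'M[L]_(m, n)) : map_mx (frob charp 0) A = A.
Proof. by apply/matrixP => i j; rewrite !mxE /frob expn0 expr1. Qed.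

End Frobenius.

Section Torus.
Variables (L : fieldType) (p : nat) (charp : p \in [pchar L]).
Variables (d : nat) (alpha : 'I_d -> L).
Hypothesis alpha_neq0 : forall i, alpha i != 0.

Local Notation phi N := (map_mx (frob charp N)).

Definition apow (n : int) : 'rV[L]_d := \row_i alpha i ^ n.
Definition adiag (n : int) : 'M[L]_d := diag_mx (apow n).

Lemma apow_adiag m n : apow m *m adiag n = apow (m + n).
Proof. by apply/rowP => i; rewrite mul_mx_diag !mxE expfzDr. Qed.

Lemma adiagD m n : adiag m *m adiag n = adiag (m + n).
Proof.
by apply/matrixP => i j; rewrite mul_mx_diag !mxE expfzDr // mulrnAl; case: eqP => [->|].
Qed.

Lemma adiag0 : adiag 0 = 1%:M.
Proof. by apply/matrixP => i j; rewrite !mxE expr0z. Qed.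

Lemma mul_adiagA m k n (A : 'M_(m, d)) : A *m adiag k *m adiag n = A *m adiag (k + n).
Proof. by rewrite -mulmxA adiagD. Qed.

Lemma mul_adiagNK m n (A : 'M_(m, d)) : A *m adiag (- n) *m adiag n = A.
Proof. by rewrite mul_adiagA addNr adiag0 mulmx1. Qed.

Lemma adiag_free n : row_free (adiag n).
Proof. by apply/row_freeP; exists (adiag (- n)); rewrite adiagD subrr adiag0. Qed.

Lemma submx_adiag m1 m2 n (A : 'M_(m1, d)) (B : 'M_(m2, d)) :
  (A *m adiag n <= B *m adiag n)%MS = (A <= B)%MS.
Proof. by rewrite submxMfree // adiag_free. Qed.

Lemma apow_submx m n k (A : 'M_(m, d)) :
  (apow n <= A *m adiag k)%MS = (apow (n - k) <= A)%MS.
Proof. by rewrite -[RHS](submx_adiag k) apow_adiag subrK. Qed.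

Lemma phi_apow N n : phi N (apow n) = apow ((p ^ N)%N%:Z * n).
Proof. by apply/rowP => i; rewrite !mxE /frob exprnP exprz_exp mulrC. Qed.

Lemma phi_adiag N n : phi N (adiag n) = adiag ((p ^ N)%N%:Z * n).
Proof.
apply/matrixP => i j; rewrite !mxE rmorphMn /=; congr (_ *+ _).
by have /rowP/(_ i) := phi_apow N n; rewrite !mxE.
Qed.

Hypothesis alpha_indep : forall i j n, i != j -> (0 < n)%N -> (alpha i / alpha j) ^+ n != 1.

Lemma expz_neq i j (x : int) : x != 0 -> i != j -> alpha i ^ x != alpha j ^ x.
Proof.
move=> x0 ij; apply/eqP => e.
have e1 : (alpha i / alpha j) ^ x = 1.
  by rewrite expfzMl exprz_inv e -expfzDr // subrr expr0z.
have := alpha_indep ij (n := `|x|%N); rewrite absz_gt0 => /(_ x0)/eqP; apply.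
case: x x0 e e1 => n // _ _; rewrite NegzE /= -exprnN => /eqP.
by rewrite invr_eq1 => /eqP.
Qed.

(* The rows alpha^(n0 + k x), k < d, lie in W and form a Vandermonde matrix. *)
Lemma adiag_stable_eq0 (W : 'M_d) n0 x : (apow n0 <= W)%MS -> (\rank W < d)%N ->
  (W *m adiag x <= W)%MS -> x = 0.
Proof.
move=> n0W rW WxW; apply: contraTeq rW => x0; rewrite -leqNgt.
have kW (k : nat) : (apow (n0 + k%:Z * x) <= W)%MS.
  elim: k => [|k IH]; first by rewrite mul0r addr0.
  apply: submx_trans WxW; rewrite apow_submx; apply: etrans IH; congr (apow _ <= _)%MS.
  by rewrite intS mulrDl mul1r addrA addrAC addrK.
pose V := Vandermonde d (apow x) *m adiag n0.
have VW : (V <= W)%MS.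
  apply/row_subP => k; apply: etrans (kW k); congr (_ <= _)%MS.
  apply/rowP => i; rewrite /V /adiag mul_mx_diag !mxE mulrC expfzDr //; congr (_ * _).
  by rewrite exprnP exprz_exp mulrC.
apply: leq_trans (mxrankS VW); rewrite mxrankMfree ?adiag_free //.
rewrite row_leq_rank row_free_unit unitmxE det_Vandermonde unitfE.
apply/prodf_neq0 => i _; apply/prodf_neq0 => j ij; rewrite subr_eq0 !mxE.
by apply: expz_neq => //; rewrite eq_sym neq_ltn ij.
Qed.

(** * Krylov spaces of a Frobenius-semilinear map *)

Section Krylov.
Variables (f : nat) (m : int) (y : nat -> 'rV[L]_d).
Hypothesis yS : forall k, y k.+1 = phi f (y k) *m adiag m.

Let Y i e : 'M_(e, d) := \matrix_(j < e) y (i + j).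

(* The first vector occurring in a linear relation between [y 0], ..., [y d]. *)
Lemma krylov_dep : exists i, (y i <= Y i.+1 d)%MS.
Proof.
have : ~~ row_free (Y 0 d.+1) by rewrite /row_free neq_ltn ltnS rank_leq_col.
rewrite -kermx_eq0 => /rowV0Pn[u /sub_kermxP uY u0].
have /existsP[i0 ui0] : [exists i, u 0 i != 0].
  apply: contraNT u0 => /existsPn h; apply/eqP/rowP => i; rewrite mxE.
  by apply/eqP; move: (h i); rewrite negbK.
case: (@arg_minnP _ i0 (fun i => u 0 i != 0) (@nat_of_ord _) ui0) => i ui imin; exists i.
have : \sum_j u 0 j *: y j = 0.
  by move: uY; rewrite mulmx_sum_row; under eq_bigr => j _ do rewrite rowK.
rewrite (bigD1 i) //= => /eqP; rewrite addr_eq0 => /eqP e.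
rewrite -(scalerK ui (y i)) e; apply/scalemx_sub; rewrite -scaleN1r; apply/scalemx_sub.
(* Indices below [i] have coefficient 0 by minimality; those above [i] are rows of [Y i.+1 d]. *)
apply: summx_sub => j ji; have [ij|] := ltnP i j; last first.
  move=> leji; have lt : (j < i)%N by rewrite ltn_neqAle leji andbT.
  have [->|/imin] := eqVneq (u 0 j) 0; first by rewrite scale0r sub0mx.
  by rewrite leqNgt lt.
apply/scalemx_sub; have lt : (j - i.+1 < d)%N by have := ltn_ord j; lia.
by have := row_sub (Ordinal lt) (Y i.+1 d); rewrite rowK /= subnKC.
Qed.

(** The injective semilinear map sending [y i] to [y i.+1] carries the inclusion at [i] to the one
    at [i.+1] and reflects it, so a single index gives all of them. *)
Lemma krylov_sub k : (y k <= Y k.+1 d)%MS.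
Proof.
have step i : (y i.+1 <= Y i.+2 d)%MS = (y i <= Y i.+1 d)%MS.
  rewrite yS; have -> : Y i.+2 d = phi f (Y i.+1 d) *m adiag m.
    apply/row_matrixP => j; rewrite rowK row_mul -map_row rowK addSn yS.
    by congr (_ *m _); apply/rowP => ?; rewrite !mxE.
  by rewrite submx_adiag map_submx.
have [i] := krylov_dep.
have all j : (y j <= Y j.+1 d)%MS = (y 0 <= Y 1 d)%MS by elim: j => // j <-.
by rewrite !all.
Qed.

(** By [krylov_sub], [y k0] lies in the span of its [d] successors, so the threshold can be lowered
    one by one. *)
Lemma krylov_descent n (W : 'M_(n, d)) k0 :
  (forall k, (k0 <= k)%N -> (y k <= W)%MS) -> forall k, (y k <= W)%MS.
Proof.
elim: k0 => [h k|k0 IH h]; first exact: h.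
apply: IH => k; rewrite leq_eqVlt => /predU1P[<-|/h //].
apply: submx_trans (krylov_sub k0) _; apply/row_subP => j; rewrite rowK.
by apply: h; rewrite addSn ltnS leq_addr.
Qed.
End Krylov.

(* [W'] is contained in the inverse image of [alpha^(-r) W] under the N-th power of Frobenius, and
   contains the points [alpha^m] of that inverse image. *)
Definition frob_step N (r : int) (W W' : 'M[L]_d) : Prop :=
  (forall m, (apow m <= W')%MS = (apow ((p ^ N)%N%:Z * m + r) <= W)%MS) /\
  (phi N W' <= W *m adiag (- r))%MS.

(** Substituting [m = p^N m' + s] into [p^M m + r] gives the residue; the second inclusion is
    twisted by [phi M] before the two are composed. *)
Lemma frob_step_trans M N r s W W' W'' : frob_step M r W W' -> frob_step N s W' W'' ->
  frob_step (M + N) (r + (p ^ M)%N%:Z * s) W W''.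
Proof.
move=> [h1 h2] [h3 h4]; split.
  move=> m; rewrite h3 h1; congr (apow _ <= _)%MS.
  rewrite expnD PoszM; ring.
rewrite -map_frob_comp; move: h4; rewrite -(map_submx (frob charp M)) => h4.
apply: submx_trans h4 _; rewrite map_mxM phi_adiag mulrN opprD -mul_adiagA.
by rewrite submx_adiag.
Qed.

Lemma frob_step_rank N r W W' : frob_step N r W W' -> (\rank W' <= \rank W)%N.
Proof.
move=> [_ /mxrankS]; rewrite mxrank_map => h; apply: leq_trans h _.
by rewrite mxrankM_maxl.
Qed.

Lemma frob_step_eqmx N r W W' : frob_step N r W W' -> \rank W' = \rank W ->
  (phi N W' :=: W *m adiag (- r))%MS.
Proof.
move=> [_ h] e; apply/eqmxP; have := (mxrank_leqif_eq h).2.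
by rewrite mxrank_map mxrankMfree ?adiag_free // e eqxx => <-.
Qed.

(** Equal rank turns both inclusions into equalities; applying [phi (N - M)] to the first one and
    comparing eliminates [W']. *)
Lemma frob_step_same M N r s W W' : (M <= N)%N ->
  frob_step M r W W' -> frob_step N s W W' -> \rank W' = \rank W ->
  (phi (N - M) W :=: W *m adiag (- (s - (p ^ (N - M))%N%:Z * r)))%MS.
Proof.
move=> MN h1 h2 e; have e1 := frob_step_eqmx h1 e; have e2 := frob_step_eqmx h2 e.
have /map_eqmx-/(_ _ (frob charp (N - M))) := e1.
rewrite map_frob_comp subnK // map_mxM phi_adiag => e3.
have e4 := eqmx_trans (eqmx_sym e3) e2.
have := eqmxMr (adiag ((p ^ (N - M))%N%:Z * r)) e4.
by rewrite mulrN mul_adiagNK mul_adiagA opprB addrC.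
Qed.

End Torus.

(** * Frobenius splittings of subfields *)

Definition subfield_pred (L : fieldType) (E : L -> Prop) : Prop :=
  [/\ E 1, forall x y, E x -> E y -> E (x - y) & forall x y, E x -> E y -> E (x / y)].

Section SubfieldType.
Variables (L : fieldType) (E : L -> Prop) (HE : subfield_pred E).

Definition subfield_bpred of subfield_pred E : pred L := fun x => `[<E x>].
Local Notation S := (subfield_bpred HE).

Lemma subfield_bpred_closed : divring_closed S.
Proof.
case: HE => h1 hB hD; split; rewrite ?unfold_in; first exact/asboolP.
  by move=> x y /asboolP hx /asboolP hy; apply/asboolP/hB.
by move=> x y /asboolP hx /asboolP hy; apply/asboolP/hD.
Qed.

HB.instance Definition _ := GRing.isDivringClosed.Build L S subfield_bpred_closed.

Record subfield_type := SubfieldElt { subfield_val :> L; _ : subfield_val \in S }.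
HB.instance Definition _ := [isSub for subfield_val].
HB.instance Definition _ := [Choice of subfield_type by <:].
HB.instance Definition _ := [SubChoice_isSubComUnitRing of subfield_type by <:].
HB.instance Definition _ := [SubComUnitRing_isSubIntegralDomain of subfield_type by <:].
HB.instance Definition _ := [SubIntegralDomain_isSubField of subfield_type by <:].
End SubfieldType.

(** With [E] presented as a field type, polynomial division, Bezout relations and matrices over [E]
    become available. *)
Lemma subfield_as_type (L : fieldType) (E : L -> Prop) : subfield_pred E ->
  exists (F : fieldType) (f : {rmorphism F -> L}), forall x, E x <-> exists y, x = f y.
Proof.
move=> HE; exists (subfield_type HE : fieldType), (val : {rmorphism subfield_type HE -> L}).
move=> x; split=> [Ex|[[y /asboolP Ey] ->]//].
have xS : x \in subfield_bpred HE by apply/asboolP.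
by exists (SubfieldElt xS).
Qed.

Definition finite_pred (T : eqType) (M : T -> Prop) : Prop :=
  exists l : seq T, forall x, M x -> x \in l.

Definition add_closed (V : nmodType) (M : V -> Prop) : Prop :=
  M 0 /\ forall x y, M x -> M y -> M (x + y).

Lemma add_closed_sum (V : nmodType) (M : V -> Prop) (I : Type) (r : seq I) (P : pred I) (F : I -> V) :
  add_closed M -> (forall i, P i -> M (F i)) -> M (\sum_(i <- r | P i) F i).
Proof. by move=> [M0 MD] h; elim/big_ind: _. Qed.

Definition lincomb (L : pzSemiRingType) (M : L -> Prop) (J : finType) (e : J -> L) (x : L) : Prop :=
  exists2 m : J -> L, (forall j, M (m j)) & x = \sum_j m j * e j.

Lemma lincomb_add_closed (L : pzSemiRingType) (M : L -> Prop) (J : finType) (e : J -> L) :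
  add_closed M -> add_closed (lincomb M e).
Proof.
move=> [M0 MD]; split=> [|_ _ [m hm ->] [m' hm' ->]].
  by exists (fun=> 0) => //; rewrite big1 // => j _; rewrite mul0r.
exists (fun j => m j + m' j); first by move=> j; apply: MD.
by rewrite -big_split; apply: eq_bigr => j _; rewrite mulrDl.
Qed.

Lemma lincomb_finite (L : nzSemiRingType) (M : L -> Prop) (J : finType) (e : J -> L) :
  finite_pred M -> finite_pred (lincomb M e).
Proof.
move=> [l hl].
exists [seq \sum_j nth 0 l (f j) * e j | f : {ffun J -> 'I_(size l)}].
move=> _ [m hm ->]; have lt j : (index (m j) l < size l)%N by rewrite index_mem; apply/hl/hm.
apply/imageP; exists [ffun j => Ordinal (lt j)] => //.
by apply: eq_bigr => j _; rewrite ffunE /= nth_index //; apply/hl/hm.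
Qed.

(** * Closure properties of subfields and adjunction of an element *)

Section SubfieldTheory.
Variables (L : fieldType) (E : L -> Prop) (HE : subfield_pred E).

Lemma sf1 : E 1. Proof. by case: HE. Qed.
Lemma sfB x y : E x -> E y -> E (x - y). Proof. by case: HE => _ h _; apply: h. Qed.
Lemma sfdiv x y : E x -> E y -> E (x / y). Proof. by case: HE => _ _; apply. Qed.
Lemma sf0 : E 0. Proof. by rewrite -(subrr 1); apply: sfB; exact: sf1. Qed.
Lemma sfN x : E x -> E (- x). Proof. by move=> h; rewrite -sub0r; apply: sfB => //; exact: sf0. Qed.
Lemma sfD x y : E x -> E y -> E (x + y).
Proof. by move=> ? /sfN ?; rewrite -[y]opprK; apply: sfB. Qed.
Lemma sfV x : E x -> E x^-1.
Proof. by move=> h; rewrite -div1r; apply: sfdiv => //; exact: sf1. Qed.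
Lemma sfM x y : E x -> E y -> E (x * y).
Proof. by move=> ? /sfV ?; rewrite -[y]invrK; apply: sfdiv. Qed.
Lemma sfX x n : E x -> E (x ^+ n).
Proof. by move=> h; elim: n => [|n IH]; rewrite ?expr0 ?exprS; [exact: sf1|exact: sfM]. Qed.
Lemma sf_add_closed : add_closed E. Proof. by split; [exact: sf0|exact: sfD]. Qed.
Lemma sf_sum (I : Type) (r : seq I) (P : pred I) (F : I -> L) :
  (forall i, P i -> E (F i)) -> E (\sum_(i <- r | P i) F i).
Proof. by move=> h; apply: add_closed_sum => //; exact: sf_add_closed. Qed.

Definition polyE (P : {poly L}) : Prop := forall i, E P`_i.

Lemma polyED P Q : polyE P -> polyE Q -> polyE (P + Q).
Proof. by move=> h h' i; rewrite coefD; apply: sfD. Qed.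
Lemma polyEB P Q : polyE P -> polyE Q -> polyE (P - Q).
Proof. by move=> h h' i; rewrite coefB; apply: sfB. Qed.
Lemma polyEM P Q : polyE P -> polyE Q -> polyE (P * Q).
Proof. by move=> h h' i; rewrite coefM; apply: sf_sum => j _; apply: sfM. Qed.
Lemma polyEC c : E c -> polyE c%:P.
Proof. by move=> h i; rewrite coefC; case: ifP => // _; exact: sf0. Qed.
Lemma polyEXn n : polyE 'X^n.
Proof. by move=> i; rewrite coefXn; case: (i == n); [exact: sf1|exact: sf0]. Qed.
Lemma polyEX P n : polyE P -> polyE (P ^+ n).
Proof.
move=> h; elim: n => [|n IH]; rewrite ?expr0 ?exprS; last exact: polyEM.
exact/polyEC/sf1.
Qed.
Lemma polyE_prod (I : Type) (r : seq I) (P : pred I) (F : I -> {poly L}) :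
  (forall i, P i -> polyE (F i)) -> polyE (\prod_(i <- r | P i) F i).
Proof. by move=> h; elim/big_ind: _ => //; [exact/polyEC/sf1 | exact: polyEM]. Qed.
Lemma polyE_sum (I : Type) (r : seq I) (P : pred I) (F : I -> {poly L}) :
  (forall i, P i -> polyE (F i)) -> polyE (\sum_(i <- r | P i) F i).
Proof. by move=> h; elim/big_ind: _ => //; [exact/polyEC/sf0 | exact: polyED]. Qed.

(** The field [E(t)], in a form that serves transcendental and algebraic [t] alike. *)
Definition adjoin (t y : L) : Prop :=
  exists P Q, [/\ polyE P, polyE Q, Q.[t] != 0 & y = P.[t] / Q.[t]].

Lemma adjoin_base t y : E y -> adjoin t y.
Proof.
move=> Ey; exists y%:P, 1; split; rewrite ?hornerC ?divr1 ?oner_neq0 //.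
  exact: polyEC.
exact/polyEC/sf1.
Qed.

Lemma adjoin_gen t : adjoin t t.
Proof.
exists 'X, 1; split; rewrite ?hornerX ?hornerC ?divr1 ?oner_neq0 //.
  exact: (@polyEXn 1).
exact/polyEC/sf1.
Qed.

Lemma adjoin_subfield t : subfield_pred (adjoin t).
Proof.
split; first exact/adjoin_base/sf1.
  move=> _ _ [P [Q [hP hQ Q0 ->]]] [P' [Q' [hP' hQ' Q0' ->]]].
  exists (P * Q' - P' * Q), (Q * Q'); split; try by do ?[apply: polyEB|apply: polyEM].
    by rewrite hornerM mulf_neq0.
  by rewrite !hornerE; field; rewrite Q0 Q0'.
move=> _ _ [P [Q [hP hQ Q0 ->]]] [P' [Q' [hP' hQ' Q0' ->]]].
have [e|nz] := eqVneq P'.[t] 0.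
  by rewrite e mul0r invr0 mulr0; apply/adjoin_base/sf0.
exists (P * Q'), (Q * P'); split; try exact: polyEM.
  by rewrite hornerM mulf_neq0.
by rewrite !hornerE; field; rewrite Q0 Q0' nz.
Qed.

Lemma adjoin_common t (J : finType) (y : J -> L) : (forall j, adjoin t (y j)) ->
  exists Q (P : J -> {poly L}), [/\ polyE Q, Q.[t] != 0, forall j, polyE (P j)
    & forall j, y j = (P j).[t] / Q.[t]].
Proof.
move=> h; have /choice[f fP] : forall j, exists PQ : {poly L} * {poly L},
    [/\ polyE PQ.1, polyE PQ.2, PQ.2.[t] != 0 & y j = PQ.1.[t] / PQ.2.[t]].
  by move=> j; have [P [Q hPQ]] := h j; exists (P, Q).
have n0 (R : pred J) : (\prod_(j | R j) (f j).2).[t] != 0.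
  by rewrite horner_prod; apply/prodf_neq0 => j _; case: (fP j).
exists (\prod_j (f j).2), (fun j => (f j).1 * \prod_(i | i != j) (f i).2); split=> //.
- by apply: polyE_prod => j _; case: (fP j).
- move=> j; apply: polyEM; first by case: (fP j).
  by apply: polyE_prod => i _; case: (fP i).
- move=> j; rewrite [\prod_j _](bigD1 j) //= !hornerM.
  have [_ _ nz ->] := fP j; have := n0 (fun i => i != j).
  by move=> nz'; field; rewrite nz nz'.
Qed.
End SubfieldTheory.

Section FrobeniusSum.
Variables (R : comNzRingType) (p : nat) (charp : p \in [pchar R]).

Lemma exprp_sum (I : Type) (r : seq I) (P : pred I) (F : I -> R) :
  (\sum_(i <- r | P i) F i) ^+ p = \sum_(i <- r | P i) F i ^+ p.
Proof.
have frobE x : frob charp 1 x = x ^+ p by rewrite /frob expn1.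
by rewrite -frobE raddf_sum; apply: eq_bigr => i _; exact: frobE.
Qed.

Lemma exprpD (x y : R) : (x + y) ^+ p = x ^+ p + y ^+ p.
Proof. by have := raddfD (frob charp 1) x y; rewrite /frob !expn1. Qed.
End FrobeniusSum.

Section FrobeniusSplitting.
Variables (L : fieldType) (p : nat) (charp : p \in [pchar L]).

Let p_gt0 : (0 < p)%N. Proof. exact: prime_gt0 (pcharf_prime charp). Qed.
Let p_gt1 : (1 < p)%N. Proof. exact: prime_gt1 (pcharf_prime charp). Qed.

(** Linear independence of [b] over the field of p-th powers of [E]. *)
Definition frob_free (E : L -> Prop) (I : finType) (b : I -> L) : Prop :=
  forall c : I -> L, (forall i, E (c i)) -> \sum_i c i ^+ p * b i = 0 -> forall i, c i = 0.

Definition frob_rep (M : L -> Prop) (I : finType) (b : I -> L) (x : L) : Prop :=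
  exists2 c : I -> L, (forall i, M (c i)) & x = \sum_i c i ^+ p * b i.

(* In the p-basis [b], multiplication by an element of [S] followed by taking p-th roots of the
   coordinates preserves a finite group: this keeps the family of subspaces finite. *)
Definition frob_split (E : L -> Prop) (I : finType) (b : I -> L) : Prop :=
  [/\ subfield_pred E, forall i, E (b i), frob_free E b
    & forall S : seq L, (forall x, x \in S -> E x) -> exists M : L -> Prop,
      [/\ finite_pred M, add_closed M, forall x, M x -> E x, forall x, x \in S -> M x
        & forall s m, s \in S -> M m -> frob_rep M b (s * m)]].

Lemma frob_rep0 M (I : finType) (b : I -> L) : add_closed M -> frob_rep M b 0.
Proof.
move=> [M0 _]; exists (fun=> 0) => //; rewrite big1 // => i _.
by rewrite expr0n eqn0Ngt p_gt0 mul0r.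
Qed.

Lemma frob_repD M (I : finType) (b : I -> L) : add_closed M -> add_closed (frob_rep M b).
Proof.
move=> MA; split; first exact: frob_rep0.
move=> _ _ [c hc ->] [c' hc' ->]; exists (fun i => c i + c' i).
  by move=> i; apply: MA.2.
by rewrite -big_split; apply: eq_bigr => i _ /=; rewrite -mulrDl (exprpD charp).
Qed.

(** On the prime field [x ^+ p = x], so the basis is 1 and the finite group [M] is the whole field.
    Fermat also gives the inverse as a power. *)
Lemma frob_split_prime : exists (E : L -> Prop) (b : 'I_1 -> L), frob_split E b.
Proof.
pose E (x : L) := exists n : nat, x = n%:R.
have Ep x : E x -> x ^+ p = x by case=> n ->; exact: (pFrobenius_aut_nat charp n).
have EM x y : E x -> E y -> E (x * y) by case=> m -> [n ->]; exists (m * n)%N; rewrite natrM.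
have EX x n : E x -> E (x ^+ n) by case=> m ->; exists (m ^ n)%N; rewrite natrX.
have ED : add_closed E.
  by split; [exists 0%N | move=> _ _ [m ->] [n ->]; exists (m + n)%N; rewrite natrD].
have sE : subfield_pred E.
  split; first by exists 1%N.
    (* [p.-1] plays the role of -1. *)
    move=> _ _ [m ->] [n ->]; exists (m + p.-1 * n)%N; rewrite natrD natrM; congr (_ + _).
    by rewrite -subn1 natrB // (pcharf0 charp) sub0r mulN1r.
  move=> x y Ex Ey; have [->|y0] := eqVneq y 0; first by exists 0%N; rewrite invr0 mulr0.
  suff -> : y^-1 = y ^+ (p - 2) by apply/EM/EX.
  apply: (mulfI y0); rewrite mulfV // -exprS; apply: (mulfI y0); rewrite -exprS mulr1.
  by have -> : (p - 2).+2 = p; [lia | rewrite Ep].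
exists E, (fun=> 1); split=> //; first by exists 1%N.
  move=> c Ec; rewrite big_ord1 mulr1 => /eqP; rewrite expf_eq0 => /andP[_ /eqP c0] i.
  by rewrite (ord1 i).
move=> S hS; exists E; split=> //.
  exists [seq n%:R | n <- iota 0 p] => _ [n ->]; apply/mapP; exists (n %% p)%N.
    by rewrite mem_iota ltn_mod p_gt0.
  by rewrite {1}(divn_eq n p) natrD natrM (pcharf0 charp) mulr0 add0r.
move=> s m /hS Es Em; exists (fun=> s * m); first by move=> _; apply: EM.
by rewrite big_ord1 mulr1 Ep //; apply: EM.
Qed.

End FrobeniusSplitting.

(** * Transcendental extensions *)

Lemma sum_ord_mul (V : nmodType) n k (F : nat -> V) :
  \sum_(i < n * k) F i = \sum_(i < n) \sum_(j < k) F (i * k + j)%N.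
Proof.
rewrite -(big_mkord xpredT F) big_nat_mul big_mkord; apply: eq_bigr => i _.
rewrite -{1}[(i * k)%N]add0n big_addn mulSn addnK big_mkord.
by apply: eq_bigr => j _; rewrite addnC.
Qed.

Section FrobeniusExtension.
Variables (L : fieldType) (p : nat) (charp : p \in [pchar L]).

Let p_gt0 : (0 < p)%N. Proof. exact: prime_gt0 (pcharf_prime charp). Qed.
Let p_gt1 : (1 < p)%N. Proof. exact: prime_gt1 (pcharf_prime charp). Qed.

(** [P ^+ p] is the polynomial with p-th power coefficients, evaluated at ['X^p]. *)
Lemma coef_exprp (P : {poly L}) k :
  (P ^+ p)`_k = if (p %| k)%N then P`_(k %/ p) ^+ p else 0.
Proof.
have charP : p \in [pchar {poly L}] by rewrite pchar_poly.
have -> : P ^+ p = map_poly (fun x => x ^+ p) P \Po 'X^p.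
  rewrite {1}(_ : P = \sum_(i < size P) P`_i *: 'X^i); last by rewrite -poly_def coefK.
  rewrite (exprp_sum charP) /map_poly poly_def raddf_sum; apply: eq_bigr => i _ /=.
  by rewrite exprZn linearZ /= comp_Xn_poly -!exprM mulnC.
rewrite coef_comp_poly_Xn //; case: ifP => // _.
by rewrite coef_map_id0 // expr0n eqn0Ngt p_gt0.
Qed.

Section Transcendental.
Variables (E : L -> Prop) (I : finType) (b : I -> L) (t : L).
Hypotheses (splitE : frob_split p E b).
Hypothesis transc : forall P, polyE E P -> P.[t] = 0 -> P = 0.
Let HE : subfield_pred E. Proof. by case: splitE. Qed.

Let bt (ij : I * 'I_p) : L := b ij.1 * t ^+ ij.2.

(** After clearing denominators, transcendence turns the relation into the polynomial identity
    [R = 0], whose coefficients are relations between the [b i]. *)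
Lemma adjoin_frob_free : frob_free p (adjoin E t) bt.
Proof.
have [_ Eb freeb _] := splitE.
move=> c hc sum0; have [Q [P [hQ Q0 hP cE]]] := adjoin_common HE hc.
pose R : {poly L} := \sum_(ij : I * 'I_p) P ij ^+ p * (b ij.1)%:P * 'X^(ij.2).
have R0 : R = 0.
  apply: transc.
    apply: (polyE_sum HE) => ij _; apply: (polyEM HE); last exact: polyEXn.
    by apply: (polyEM HE); [apply: polyEX | apply: polyEC].
  apply: (mulIf (expf_neq0 p (invr_neq0 Q0))); rewrite mul0r -[RHS]sum0 horner_sum mulr_suml.
  apply: eq_bigr => ij _; rewrite !hornerM horner_exp hornerC hornerXn cE /bt exprMn.
  by rewrite -!mulrA; congr (_ * _); rewrite [RHS]mulrC -!mulrA.
suff P0 ij : P ij = 0 by move=> ij; rewrite cE P0 horner0 mul0r.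
case: ij => i0 l; apply/polyP => a; rewrite coef0.
apply: (freeb (fun i => (P (i, l))`_a)) => [i|]; first exact: hP.
(* In degree [a * p + l] only the summands with [j = l] survive, by uniqueness of the remainder
   modulo [p]. *)
have /polyP/(_ (a * p + l)%N) := R0; rewrite coef0 coef_sum => R0k; apply: etrans R0k.
rewrite [RHS](_ : _ = \sum_i \sum_(j < p) ((P (i, j)) ^+ p * (b i)%:P * 'X^j)`_(a * p + l));
  last by rewrite pair_bigA; apply: eq_bigr => -[].
apply: eq_bigr => i _; rewrite (bigD1 l) //= big1 => [|j jl].
  by rewrite coefMXn ltnNge leq_addl addnK coefMC coef_exprp dvdn_mull // mulnK // addr0.
rewrite coefMXn; case: ltnP => // le; rewrite coefMC coef_exprp.
case: ifP => [/dvdnP[m e]|_]; last by rewrite mul0r.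
have e2 : (a * p + l = m * p + j)%N by rewrite -e subnK.
have := congr1 (modn^~ p) e2; rewrite !modnMDl !modn_small // => e3.
by move: jl; rewrite -val_eqE /= e3 eqxx.
Qed.

(** [M] consists of the [y(t) / g(t)] with [y] of size at most [B] and coefficients in the group
    [M0] for [E]. A product is a numerator of size at most [B * p] over [g(t) ^+ p], and taking p-th
    roots brings the size back to [B]. *)
Lemma frob_split_transcendental : frob_split p (adjoin E t) bt.
Proof.
have [_ Eb freeb stable] := splitE.
split; [exact: adjoin_subfield | | exact: adjoin_frob_free |].
  move=> ij; apply: (sfM (adjoin_subfield HE t)); first exact/adjoin_base.
  apply: (sfX (adjoin_subfield HE t)); exact: adjoin_gen.
move=> S hS; have hS' (j : 'I_(size S)) : adjoin E t S`_j by apply/hS/mem_nth.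
have [g [P [hg g0 hP SE]]] := adjoin_common HE hS'.
(* [(P j / g) (y / g) = C j * y / g ^+ p], which puts the denominator in p-th power form. *)
pose C j := P j * g ^+ (p - 2).
pose S0 := flatten [seq (P j : seq L) ++ (C j : seq L) | j : 'I_(size S)].
have S0P j : {subset (P j : seq L) <= S0}.
  by move=> x xP; apply/flatten_imageP; exists j; rewrite // mem_cat xP.
have S0C j : {subset (C j : seq L) <= S0}.
  by move=> x xP; apply/flatten_imageP; exists j; rewrite // mem_cat xP orbT.
have [|M0 [fin add sub inS rep]] := stable S0.
  move=> x /flatten_imageP[j _]; rewrite mem_cat => /orP[] /(nthP 0)[i _ <-]; first exact: hP.
  by apply: (polyEM HE) => //; apply: polyEX.
(* Large enough for [S] to lie in [M], and for [C j * y] to have size at most [2 B], hence at most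
   [B * p]. *)
pose B := (\sum_j (size (P j) + size (C j)))%N.
have leB j : (size (P j) + size (C j) <= B)%N by rewrite /B (bigD1 j) //= leq_addr.
pose e (j : 'I_B) := t ^+ j / g.[t].
exists (lincomb M0 e); split.
- exact: lincomb_finite.
- exact: lincomb_add_closed.
- move=> _ [m hm ->]; apply: (sf_sum (adjoin_subfield HE t)) => j _.
  apply: (sfM (adjoin_subfield HE t)); first exact/adjoin_base/sub.
  by exists 'X^j, g; split=> //; [exact: polyEXn | rewrite hornerXn].
- move=> x /(nthP 0)[i ilt <-]; rewrite -[i]/(val (Ordinal ilt)) SE.
  set j := Ordinal ilt; exists (fun l : 'I_B => (P j)`_l).
    move=> l; have [lt|ge] := ltnP l (size (P j)); first exact/inS/(S0P j)/mem_nth.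
    by rewrite nth_default //; case: add.
  rewrite (@horner_coef_wide _ B) ?(leq_trans (leq_addr _ _) (leB j)) // mulr_suml.
  by apply: eq_bigr => l _; rewrite mulrA.
move=> x _ /(nthP 0)[i ilt <-] [m hm ->]; rewrite -[i]/(val (Ordinal ilt)) SE.
set j := Ordinal ilt.
pose y : {poly L} := \poly_(l < B) (if insub l is Some l' then m l' else 0).
have yM l : M0 y`_l.
  rewrite coef_poly; case: ifP => [lt|_]; last by case: add.
  by case: insubP => // _; case: add.
have yE : \sum_l m l * e l = y.[t] / g.[t].
  rewrite horner_poly mulr_suml; apply: eq_bigr => l _; rewrite valK /e mulrA //.
pose R := C j * y.
have repR k : frob_rep p M0 b R`_k.
  rewrite coefM; apply: add_closed_sum => [|l _]; first exact: frob_repD.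
  have [lt|ge] := ltnP l (size (C j)).
    by apply: rep => //; apply/(S0C j)/mem_nth.
  by rewrite nth_default // mul0r; apply: frob_rep0.
have szR : (size R <= B * p)%N.
  apply: leq_trans (size_polyMleq _ _) _.
  have := leq_trans (leq_addl _ _) (leB j); have : (size y <= B)%N by apply: size_poly.
  by move: p_gt1; nia.
have /choice[c hc] : forall k, exists c : I -> L,
    (forall i, M0 (c i)) /\ R`_k = \sum_i c i ^+ p * b i.
  by move=> k; have [c ? ?] := repR k; exists c.
exists (fun ij : I * 'I_p => \sum_(l < B) c (l * p + ij.2)%N ij.1 * e l).
  by move=> ij; exists (fun l : 'I_B => c (l * p + ij.2)%N ij.1) => // l; case: (hc (l * p + ij.2)%N).
have -> : (P j).[t] / g.[t] * (\sum_l m l * e l) = R.[t] / g.[t] ^+ p.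
  rewrite yE /R /C !hornerM horner_exp; have {2}-> : p = (p - 2).+2 by lia.
  by rewrite !exprS; field; rewrite g0 expf_neq0.
rewrite (horner_coef_wide _ szR) (sum_ord_mul _ _ (fun k => R`_k * t ^+ k)) mulr_suml.
under [RHS]eq_bigr => ij _ do rewrite (exprp_sum charp) mulr_suml.
rewrite exchange_big /=; apply: eq_bigr => l _; rewrite mulr_suml.
rewrite -(pair_bigA _ (fun i (j : 'I_p) => (c (l * p + j)%N i * e l) ^+ p * bt (i, j))) /=.
rewrite exchange_big /=; apply: eq_bigr => k _; rewrite (hc _).2 mulr_suml mulr_suml.
apply: eq_bigr => i' _; rewrite /bt /e /= !exprMn exprVn exprD exprM; ring.
Qed.
End Transcendental.
End FrobeniusExtension.

(** * Algebraic extensions *)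

Section FrobeniusExtension.
Variables (L : fieldType) (p : nat) (charp : p \in [pchar L]).

Let p_gt0 : (0 < p)%N. Proof. exact: prime_gt0 (pcharf_prime charp). Qed.

Lemma polyE_map (E : L -> Prop) (F : fieldType) (f : {rmorphism F -> L}) :
  (forall x, E x <-> exists y, x = f y) ->
  forall P, polyE E P -> exists P0, P = map_poly f P0.
Proof.
move=> Ef P hP; have /choice[g hg] : forall i, exists y, P`_i = f y by move=> i; apply/Ef.
exists (\poly_(i < size P) g i); apply/polyP => i; rewrite coef_map coef_poly.
case: ltnP => [_|ge]; first exact: hg.
by rewrite nth_default //; apply/esym/raddf0.
Qed.

(* Since [t] and [t ^+ p] have the same degree [N] over [E], the powers of either of them form a
   basis of [E(t)]; no separability is needed beyond this. *)
Section Algebraic.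
Variables (E : L -> Prop) (I : finType) (b : I -> L) (t : L) (N : nat).
Variables (F : fieldType) (f : {rmorphism F -> L}) (P0 : {poly F}).
Hypotheses (splitE : frob_split p E b).
Hypothesis Ef : forall x, E x <-> exists y, x = f y.
Hypotheses (szP0 : size P0 = N.+1) (rootP0 : root (map_poly f P0) t).
Hypothesis mint : forall Q, Q != 0 -> root (map_poly f Q) t -> (N < size Q)%N.
Hypothesis mintp : forall Q, Q != 0 -> root (map_poly f Q) (t ^+ p) -> (N < size Q)%N.
Let HE : subfield_pred E. Proof. by case: splitE. Qed.
Let P0_neq0 : P0 != 0. Proof. by rewrite -size_poly_gt0 szP0. Qed.

Let coords (x : L) (u : 'rV[F]_N) := \sum_i f (u 0 i) * x ^+ i.

Let coords_rVpoly x u : coords x u = (map_poly f (rVpoly u)).[x].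
Proof.
rewrite (@horner_coef_wide _ N) ?size_map_poly ?size_poly //.
by apply: eq_bigr => i _; rewrite coef_map coef_rVpoly_ord.
Qed.

Let coords_inj x : (forall Q, Q != 0 -> root (map_poly f Q) x -> (N < size Q)%N) ->
  forall u, coords x u = 0 -> u = 0.
Proof.
move=> minx u; rewrite coords_rVpoly => /eqP; rewrite -/(root _ _) => r.
apply: contraTeq (size_poly N (fun k => if insub k is Some i then u 0 i else 0)) => u0.
rewrite -ltnNge; apply: minx => //; apply: contraNneq u0 => e.
by rewrite -(rVpolyK u) /rVpoly e linear0.
Qed.

Let adjoin_coords y : adjoin E t y -> exists u, y = coords t u.
Proof.
move=> [_ [_ [/(polyE_map Ef)[A ->] /(polyE_map Ef)[B ->] B0 ->]]].
(* Since [B] does not vanish at [t], the cofactor of the gcd in [P0] still does; minimality forces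
   it to have full degree, so the gcd is constant. *)
have cop : coprimep P0 B.
  rewrite coprimep_def; apply/eqP.
  have /dvdpP[h hE] := dvdp_gcdl P0 B; have /dvdpP[h' hE'] := dvdp_gcdr P0 B.
  have g0 : gcdp P0 B != 0 by rewrite gcdp_eq0 negb_and P0_neq0.
  have h0 : h != 0 by apply: contraNneq P0_neq0 => e; rewrite hE e mul0r.
  have /mint : root (map_poly f h) t.
    move: rootP0; rewrite {1}hE rmorphM rootM => /orP[//|rg].
    by move: B0; rewrite hE' rmorphM hornerM (eqP rg) mulr0 eqxx.
  move=> /(_ h0) lt; have szE : (size h + size (gcdp P0 B)).-1 = N.+1.
    by rewrite -size_mul // -hE.
  by move: szE g0 lt; rewrite -size_poly_gt0; lia.
have [[u v] /= uv] := Bezout_eq1_coprimepP _ _ cop.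
have Binv : (map_poly f B).[t]^-1 = (map_poly f v).[t].
  apply: (mulfI B0); rewrite mulfV // -hornerM -rmorphM mulrC.
  have := congr1 (fun q => (map_poly f q).[t]) uv.
  by rewrite rmorphD !rmorphM /= hornerD !hornerM (eqP rootP0) mulr0 add0r rmorph1 hornerC.
exists (poly_rV ((A * v) %% P0)).
rewrite coords_rVpoly poly_rV_K; last by rewrite -ltnS -szP0 ltn_modp.
rewrite Binv -hornerM -rmorphM {1}(divp_eq (A * v) P0) rmorphD rmorphM hornerD hornerM.
by rewrite (eqP rootP0) mulr0 add0r.
Qed.

(** The matrix [C] of the powers of [t ^+ p] in terms of those of [t] is square, and invertible
    because [mintp] makes the former independent. *)
Let adjoin_coordsp y : adjoin E t y -> exists u, y = coords (t ^+ p) u.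
Proof.
have tA := adjoin_gen HE t; have sA := adjoin_subfield HE t.
have /choice[c cE] (j : 'I_N) : exists u, (t ^+ p) ^+ j = coords t u.
  by apply: adjoin_coords; do 2!apply: (sfX sA).
pose C := \matrix_(j < N) c j.
have CE u : coords (t ^+ p) u = coords t (u *m C).
  rewrite /coords; under eq_bigr => j _ do rewrite cE mulr_sumr.
  rewrite exchange_big; apply: eq_bigr => i _ /=; rewrite !mxE rmorph_sum mulr_suml.
  by apply: eq_bigr => j _; rewrite !mxE rmorphM mulrA.
have uC : C \in unitmx.
  rewrite -row_free_unit -kermx_eq0; apply/rowV0P => u /sub_kermxP uC0.
  by apply: (coords_inj mintp); rewrite CE uC0 /coords big1 // => i _; rewrite mxE rmorph0 mul0r.
move=> /adjoin_coords[u ->]; exists (u *m invmx C).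
by rewrite CE mulmxKV.
Qed.

Let E_f y : E (f y). Proof. by apply/Ef; exists y. Qed.

(** [M] consists of the combinations of powers of [t] with coefficients in [M0]. A product is
    expanded in powers of [t ^+ p], its coefficients in [b]; both then have p-th roots in the
    required form. *)
Lemma frob_split_algebraic : frob_split p (adjoin E t) b.
Proof.
have [_ Eb freeb stable] := splitE; have sA := adjoin_subfield HE t.
split=> //; first by move=> i; apply/adjoin_base.
  move=> c /(_ _)/adjoin_coords-/choice[u cE] sum0 i.
  have /choice[b0 bE] : forall i, exists y, b i = f y by move=> j; apply/Ef.
  (* The p-th power of a combination of powers of [t] is one of powers of [t ^+ p]; their
     independence reduces the relation to [E]. *)
  have /(coords_inj mintp)/rowP s0 : coords (t ^+ p) (\row_j \sum_i u i 0 j ^+ p * b0 i) = 0.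
    rewrite -[RHS]sum0 /coords; under eq_bigr => j _ do rewrite mxE rmorph_sum mulr_suml.
    rewrite exchange_big; apply: eq_bigr => i' _ /=; rewrite cE (exprp_sum charp) mulr_suml.
    apply: eq_bigr => j _; rewrite rmorphM rmorphXn bE exprMn -!exprM (mulnC p); ring.
  rewrite cE /coords big1 // => j _.
  have -> : f (u i 0 j) = 0.
    apply: (freeb (fun i => f (u i 0 j))) => // .
    have := s0 j; rewrite !mxE => /(congr1 f); rewrite rmorph0 rmorph_sum => e.
    apply: etrans e.
    by apply: eq_bigr => i' _; rewrite rmorphM rmorphXn bE.
  by rewrite mul0r.
move=> S hS.
have /choice[c1 c1E] x : exists u, adjoin E t x -> x = coords t u.
  by have [/adjoin_coords[u]|] := pselect (adjoin E t x); [exists u | exists 0].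
have /choice[c2 c2E] x : exists u, adjoin E t x -> x = coords (t ^+ p) u.
  by have [/adjoin_coordsp[u]|] := pselect (adjoin E t x); [exists u | exists 0].
pose S0 := [seq f (c1 s 0 i) | s <- S, i <- enum 'I_N] ++
  [seq f (c2 (s * t ^+ ij.1) 0 ij.2) |
    s : L <- S, ij : ('I_N * 'I_N)%type <- enum {: 'I_N * 'I_N}].
have [|M0 [fin add sub inS rep]] := stable S0.
  by move=> x; rewrite mem_cat => /orP[]/allpairsP[[s i] [_ _ ->]].
exists (lincomb M0 (fun i : 'I_N => t ^+ i)); split.
- exact: lincomb_finite.
- exact: lincomb_add_closed.
- move=> _ [m hm ->]; apply: (sf_sum sA) => j _.
  by apply: (sfM sA); [apply/adjoin_base/sub | apply/(sfX sA)/adjoin_gen].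
- move=> x xS; exists (fun i => f (c1 x 0 i)); last exact/c1E/hS.
  move=> i; apply: inS; rewrite mem_cat; apply/orP; left.
  by apply/allpairsP; exists (x, i); rewrite mem_enum.
move=> s _ sS [m hm ->].
have repj (j : 'I_N) : frob_rep p M0 b (\sum_i m i * f (c2 (s * t ^+ i) 0 j)).
  apply: add_closed_sum => [|i _]; first exact: frob_repD.
  rewrite mulrC; apply: rep => //; rewrite mem_cat; apply/orP; right.
  by apply/allpairsP; exists (s, (i, j)); rewrite mem_enum.
have /choice[c hc] : forall j : 'I_N, exists c : I -> L,
   (forall i, M0 (c i)) /\ \sum_i m i * f (c2 (s * t ^+ i) 0 j) = \sum_i c i ^+ p * b i.
  by move=> j; have [c ? ?] := repj j; exists c.
exists (fun i => \sum_j c j i * t ^+ j).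
  by move=> i; exists (fun j => c j i) => // j; case: (hc j).
transitivity (\sum_j (\sum_i c j i ^+ p * b i) * (t ^+ p) ^+ j).
  under [RHS]eq_bigr => j _ do rewrite -(hc j).2 mulr_suml.
  rewrite exchange_big mulr_sumr; apply: eq_bigr => i _ /=.
  rewrite mulrCA {1}[s * _]c2E; last by apply: (sfM sA); [apply: hS | apply/(sfX sA)/adjoin_gen].
  by rewrite mulr_sumr; apply: eq_bigr => j _; rewrite mulrA.
under eq_bigr => j _ do rewrite mulr_suml.
rewrite exchange_big; apply: eq_bigr => i _ /=; rewrite (exprp_sum charp) mulr_suml.
by apply: eq_bigr => j _; rewrite exprMn -!exprM (mulnC p) mulrAC.
Qed.
End Algebraic.

(** Elements are adjoined one at a time. An algebraic [x] is replaced by that [x ^+ (p ^ k')] whose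
    degree over [E] is least; a further p-th power then keeps the degree, as [frob_split_algebraic]
    requires. *)
Lemma frob_split_tower (xs : seq L) : exists (E : L -> Prop) (I : finType) (b : I -> L) (k : nat),
  frob_split p E b /\ forall x, x \in xs -> E (x ^+ (p ^ k)).
Proof.
elim: xs => [|x xs [E [I [b [k [splitE hE]]]]]].
  by have [E [b splitE]] := frob_split_prime charp; exists E, 'I_1, b, 0%N.
have [HE _ _ _] := splitE.
have [transc|] := pselect (forall P, polyE E P -> P.[x] = 0 -> P = 0).
  exists (adjoin E x), (I * 'I_p)%type, (fun ij : I * 'I_p => b ij.1 * x ^+ ij.2), k.
  split; first exact: (frob_split_transcendental charp splitE transc).
  move=> y; rewrite inE => /predU1P[->|/hE Ey]; last exact: adjoin_base.
  exact/(sfX (adjoin_subfield HE x))/adjoin_gen.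
move=> ntr; have [F [f Ef]] := subfield_as_type HE.
pose algdeg n := `[< exists k' (P : {poly F}), [/\ P != 0, root (map_poly f P) (x ^+ (p ^ k')) & size P = n.+1] >].
have ex : exists n, algdeg n.
  have [P [hP rP nz]] : exists P, [/\ polyE E P, P.[x] = 0 & P <> 0].
    apply: contrapT => h; apply: ntr => P hP rP; apply: contrapT => nz.
    by apply: h; exists P.
  have [P' PE] := polyE_map Ef hP.
  have P'0 : P' != 0 by apply/eqP => e; apply: nz; rewrite PE e rmorph0.
  exists (size P').-1; apply/asboolP; exists 0%N, P'; split=> //.
    by rewrite expn0 expr1 -PE; apply/eqP.
  by rewrite prednK // size_poly_gt0.
case: (ex_minnP ex) => N /asboolP[k' [P [P0 rP szP]]] minN.
have min j Q : Q != 0 -> root (map_poly f Q) (x ^+ (p ^ j)) -> (N < size Q)%N.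
  move=> Q0 rQ; rewrite -(prednK (n := size Q)) ?size_poly_gt0 // ltnS.
  apply: minN; apply/asboolP; exists j, Q; split=> //.
  by rewrite prednK // size_poly_gt0.
exists (adjoin E (x ^+ (p ^ k'))), I, b, (k' + k)%N; split.
  apply: frob_split_algebraic splitE Ef szP rP _ _; first exact: min.
  by move=> Q; rewrite -exprM -expnSr; apply: min.
have sA := adjoin_subfield HE (x ^+ (p ^ k')).
move=> y; rewrite inE => /predU1P[->|/hE Ey].
  by rewrite expnD exprM; apply/(sfX sA)/adjoin_gen.
by rewrite addnC expnD exprM; apply/(sfX sA)/adjoin_base.
Qed.
End FrobeniusExtension.

(** * Zero sets of finite systems of subspaces *)

Lemma pigeonhole (T : finType) (g : nat -> T) : exists i j, (i < j)%N /\ g i = g j.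
Proof.
apply: contrapT => h.
have inj : injective (fun i : 'I_#|T|.+1 => g i).
  move=> i j e; apply/val_inj; have [ij|ij|//] := ssrnat.ltngtP (val i) (val j).
    by case: h; exists i, j.
  by case: h; exists j, i.
by have := leq_card _ inj; rewrite card_ord ltnn.
Qed.

Lemma PoszX (m k : nat) : (m ^ k)%N%:Z = m%:Z ^+ k.
Proof. by rewrite -[LHS]natz natrX natz. Qed.

(* The k-th iterate of n |-> q n + u is n |-> q^k n + geom q u k. *)
Definition geom (q u : int) (k : nat) : int := iter k (fun x => q * x + u) 0.

Lemma geomS q u k : geom q u k.+1 = q * geom q u k + u.
Proof. by []. Qed.

Lemma geom_closed q u k : (q - 1) * geom q u k = u * (q ^+ k - 1).
Proof.
elim: k => [|k IH]; first by rewrite subrr !mulr0.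
by rewrite geomS mulrDr mulrCA IH exprS; ring.
Qed.

(** Undoing a step divides [(q - 1) * n + u], a multiple of the distance to the fixed point, by [q];
    so this stops unless that number is 0. *)
Lemma affine_orbit (q u n : int) : 1 < q ->
  (q - 1) * n + u = 0 \/
  exists k n0, n = q ^+ k * n0 + geom q u k /\ ~~ (q %| n0 - u)%Z.
Proof.
move=> q1; have [m] := ubnP (absz ((q - 1) * n + u)); elim: m n => // m IH n.
rewrite ltnS => le; have [/dvdzP[n1 e]|nd] := boolP (q %| n - u)%Z; last first.
  by right; exists 0%N, n; rewrite mul1r addr0.
have {}e : n = q * n1 + u by rewrite mulrC -e subrK.
have e2 : (q - 1) * n + u = q * ((q - 1) * n1 + u) by rewrite e; ring.
have [->|nz] := eqVneq ((q - 1) * n + u) 0; first by left.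
have /IH[h|[k [n0 [e1 nd]]]] : (absz ((q - 1) * n1 + u)%R < m)%N.
  apply: leq_trans le; rewrite e2 abszM ltn_Pmull //; first by lia.
  by move: nz; rewrite e2 mulf_eq0 negb_or absz_gt0 => /andP[].
- by move: nz; rewrite e2 h mulr0 eqxx.
- by right; exists k.+1, n0; split=> //; rewrite e e1 geomS exprS; ring.
Qed.

Section ZeroSets.
Variables (L : fieldType) (p : nat) (charp : p \in [pchar L]).
Variables (d : nat) (alpha : 'I_d -> L).
Hypothesis alpha_neq0 : forall i, alpha i != 0.

Local Notation phi N := (map_mx (frob charp N)).
Local Notation apow := (apow alpha).
Local Notation adiag := (adiag alpha).
Local Notation frob_step := (frob_step charp alpha).
Local Notation zeros W := (fun n : int => (apow n <= W)%MS).

Let p_gt1 : (1 < p)%N. Proof. exact: prime_gt1 (pcharf_prime charp). Qed.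

Definition frob_period (f : nat) (u : int) (W : 'M[L]_d) : Prop :=
  (phi f W :=: W *m adiag (- u))%MS.

Lemma frob_period_iter f u W k : frob_period f u W ->
  frob_period (f * k) (geom (p ^ f)%N%:Z u k) W.
Proof.
move=> per; elim: k => [|k IH].
  by rewrite /frob_period muln0 map_frob0 oppr0 adiag0 mulmx1.
have /map_eqmx-/(_ _ (frob charp f)) := IH.
rewrite map_frob_comp -mulnS map_mxM phi_adiag // => e; apply: eqmx_trans e _.
apply: eqmx_trans (eqmxMr _ per) _; rewrite mul_adiagA //.
by rewrite geomS mulrN opprD addrC.
Qed.

Lemma frob_period_zeros f u W n : frob_period f u W ->
  (apow ((p ^ f)%N%:Z * n + u) <= W)%MS = (apow n <= W)%MS.
Proof.
by move=> per; rewrite -[RHS](map_submx (frob charp f)) per phi_apow // apow_submx // opprK.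
Qed.

Lemma frob_period_orbit f u W n k : frob_period f u W ->
  (apow ((p ^ f)%N%:Z ^+ k * n + geom (p ^ f)%N%:Z u k) <= W)%MS = (apow n <= W)%MS.
Proof.
move=> per; rewrite -(frob_period_zeros n (frob_period_iter k per)).
by rewrite expnM (PoszX (p ^ f)%N k).
Qed.

(** * Closing elementary sets under the periodicity map *)

Section Saturation.
Variables (f : nat) (u : int) (W : 'M[L]_d).
Hypotheses (f_gt0 : (0 < f)%N) (per : frob_period f u W).
Let q := (p ^ f)%N.
Let q_gt1 : (1 < q)%N. Proof. by rewrite /q -[X in (X < _)%N](exp1n f) ltn_exp2r. Qed.
Let q_gt0 : (0 < q)%N := ltnW q_gt1.
Let Q : rat := q.-1%:R.
Let Q0 : Q != 0. Proof. by rewrite pnatr_eq0 -lt0n -subn1 subn_gt0. Qed.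
Let QE : q%:R = Q + 1 :> rat. Proof. by rewrite /Q natr1 prednK. Qed.
(* The fixed point of [n |-> q n + u]. *)
Let c0 : rat := - u%:~R / Q.

(** The k-th iterate sends [x] to [c0 + q^k (x - c0)]: the factor [q^k] on [e.1 - c0] becomes a new
    term, and the remaining exponents grow by [k]. *)
Let sat (e : rat * seq rat) : rat * seq rat := (c0, (e.1 - c0) :: e.2).

Let sat_ok e : elem_ok q e -> elem_ok q (sat e).
Proof.
have c0i : Q * c0 \is a Num.int by rewrite mulrC divfK // rpredN intr_int.
move=> [e1 e2 e3]; split=> //=.
- by case=> [|i] /=; [rewrite mulrBr rpredB | exact: e2].
- by rewrite big_ord_recl /= addrA [c0 + _]addrC subrK.
Qed.

Let geomE m k : Q * (geom q%:Z m k)%:~R = m%:~R * ((q ^ k)%:R - 1) :> rat.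
Proof.
have -> : Q = (q%:Z - 1)%:~R by rewrite rmorphB /= -pmulrn QE addrK.
rewrite -intrM geom_closed intrM rmorphB /= -pmulrn natrX.
by rewrite rmorphXn.
Qed.

Let XE k : (q%:Z ^+ k)%:~R = (q ^ k)%:R :> rat.
Proof. by rewrite -PoszX -pmulrn. Qed.

Let c0E k : c0 + (q ^ k)%:R * - c0 = (geom q%:Z u k)%:~R.
Proof. by apply: (mulfI Q0); rewrite geomE /c0; field. Qed.

Let satE e k n : elem_set q e n -> elem_set q (sat e) (q%:Z ^+ k * n + geom q%:Z u k).
Proof.
move=> [ks nE]; exists (fun i => if i is j.+1 then k + ks j else k)%N.
rewrite /elem_val /= big_ord_recl /= intrD intrM -c0E nE /elem_val.
rewrite XE.
under [in RHS]eq_bigr => i _ do rewrite expnD natrM mulrCA.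
by rewrite -mulr_sumr; ring.
Qed.

(* If all exponents are at least the first one, the integer is an iterate of an element of [e];
   then [krylov_descent] frees the other exponents one at a time. *)
Let sat_sub e n : elem_ok q e -> (forall m, elem_set q e m -> zeros W m) ->
  elem_set q (sat e) n -> zeros W n.
Proof.
move=> ok sub [ks nE].
have oks := sat_ok ok.
(* The exponents with index 1 to [i] are free, the later ones at least [ks 0]; the induction frees
   one more at each step. *)
suff H i : (i <= size e.2)%N -> forall ks,
    (forall j, (i < j <= size e.2)%N -> (ks 0 <= ks j)%N) ->
    forall n : int, n%:~R = elem_val q (sat e) ks -> zeros W n.
  by apply: (H (size e.2) _ ks _ _ nE) => // j /andP[lt]; rewrite leqNgt lt.
elim: i => [_ {n nE}ks h n|i IH ilt {n nE}ks h n nE].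
  rewrite /elem_val /= big_ord_recl /= => nE.
  pose ls j := (ks j.+1 - ks 0)%N.
  have /intrP[m mE] := elem_val_int ls q_gt0 ok.
  have -> : n = q%:Z ^+ ks 0%N * m + geom q%:Z u (ks 0%N).
    apply: (@intr_inj rat); rewrite nE intrD intrM -c0E -mE /elem_val.
    rewrite XE mulrDr mulr_sumr.
    have -> : \sum_(i < size e.2) e.2`_i * (q ^ ks i.+1)%:R =
              \sum_(i < size e.2) (q ^ ks 0%N)%:R * (e.2`_i * (q ^ ls i)%:R).
      apply: eq_bigr => i _; rewrite mulrCA -natrM -expnD subnKC //.
      by apply: h; rewrite ltn_ord.
    by ring.
  by rewrite frob_period_orbit //; apply: sub; exists ls.
(* Only exponent [i.+1] varies. With [m] equal to [q - 1] times its coefficient, the value is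
   [n0 + geom q m k], an orbit to which the Krylov argument applies. *)
pose kz k j := if j == i.+1 then k else ks j.
have e2 := let: And3 _ e2 _ := oks in e2.
have /intrP[m mE] := e2 i.+1 (ilt : (i.+1 < size (sat e).2)%N).
have /intrP[n0 n0E] := elem_val_int (kz 0%N) q_gt0 oks.
have kzE k : elem_val q (sat e) (kz k) = (n0 + geom q%:Z m k)%:~R.
  have -> : (n0 + geom q%:Z m k)%:~R = elem_val q (sat e) (kz 0%N) + (sat e).2`_i.+1 * ((q ^ k)%:R - 1).
    by rewrite intrD -n0E; congr (_ + _); apply: (mulfI Q0); rewrite geomE -mE mulrA.
  rewrite /elem_val -addrA; congr (_ + _).
  have ilt' : (i.+1 < size (sat e).2)%N by [].
  rewrite (bigD1 (Ordinal ilt')) //= [in RHS](bigD1 (Ordinal ilt')) //=.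
  have E j : \sum_(l < (size e.2).+1 | l != Ordinal ilt')
     (e.1 - c0 :: e.2)`_l * (q ^ kz j l)%:R =
      \sum_(l < (size e.2).+1 | l != Ordinal ilt') (e.1 - c0 :: e.2)`_l * (q ^ ks l)%:R.
    by apply: eq_bigr => l li; rewrite /kz -[_ == i.+1]/(l == Ordinal ilt') (negPf li).
  by rewrite !E {1 2}/kz eqxx expn0; ring.
have zk k : (ks 0 <= k)%N -> zeros W (n0 + geom q%:Z m k).
  move=> lek; apply: (IH (ltnW ilt) (kz k)) => // j /andP[ij js].
  by rewrite /kz /=; case: eqP => // /eqP ne; apply: h; rewrite ltn_neqAle eq_sym ne ij.
have -> : n = n0 + geom q%:Z m (ks i.+1).
  apply: (@intr_inj rat); rewrite nE -kzE /elem_val; congr (_ + _).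
  by apply: eq_bigr => l _; rewrite /kz; case: eqP => [->|].
pose y k := apow (geom q%:Z m k).
have yS k : y k.+1 = phi f (y k) *m adiag m by rewrite phi_apow // apow_adiag.
rewrite -[n0]opprK addrC -apow_submx //.
apply: (krylov_descent alpha_neq0 yS (k0 := ks 0%N)) => k lek.
by rewrite /y apow_submx // opprK addrC; apply: zk.
Qed.

(** [X] may exceed the set of iterates of [Y]; being squeezed between these and the zeros of [W] is
    what the covering argument uses. *)
Lemma nested_saturate w (Y : int -> Prop) : nested q w Y ->
  (forall n, Y n -> zeros W n) ->
  exists X : int -> Prop, [/\ nested q w.+1 X, forall n, X n -> zeros W n
    & forall n k, Y n -> X (q%:Z ^+ k * n + geom q%:Z u k)].
Proof.
move=> [E [h1 h2]] YZ.
exists (fun n => exists2 e, e \in [seq sat e | e <- E] & elem_set q e n); split.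
- exists [seq sat e | e <- E]; split=> // _ /mapP[e /h1[ok sz] ->].
  by split; [apply: sat_ok | rewrite /= ltnS].
- move=> n [_ /mapP[e eE ->]]; apply: sat_sub; first exact: (h1 _ eE).1.
  by move=> m em; apply: YZ; apply/h2; exists e.
- move=> n k /h2[e eE en]; exists (sat e); first exact: map_f.
  exact: satE.
Qed.
End Saturation.


Lemma zeros_affine N r W W' : frob_step N r W W' ->
  forall n : int, ((p ^ N)%N%:Z %| n - r)%Z -> zeros W n ->
  exists2 m, zeros W' m & n = (p ^ N)%N%:Z * m + r.
Proof.
move=> [h _] n /dvdzP[m e] zn; have {}e : n = (p ^ N)%N%:Z * m + r.
  by rewrite mulrC -e subrK.
by exists m; rewrite ?h -?e.
Qed.

(** * Induction on dimension in a finite family closed under Frobenius steps *)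

Section States.
Variables (T : finType) (W : T -> 'M[L]_d).
Hypothesis alpha_indep : forall i j n, i != j -> (0 < n)%N -> (alpha i / alpha j) ^+ n != 1.
Hypothesis step : forall s (r : nat), (r < p)%N -> exists s', frob_step 1 r (W s) (W s').

(** The base-p digits of [r] are consumed from the lowest one. *)
Lemma multi_step N s (r : nat) : (r < p ^ N)%N -> exists s', frob_step N r (W s) (W s').
Proof.
elim: N s r => [|N IH] s r.
  rewrite expn0 ltnS leqn0 => /eqP->; exists s; split.
    by move=> m; rewrite expn0 mul1r addr0.
  by rewrite map_frob0 oppr0 adiag0 mulmx1.
rewrite expnS mulnC => rlt; have p0 := ltnW p_gt1.
have [s1 h1] := step s (ltn_pmod r p0).
have [|s2 h2] := IH s1 (r %/ p)%N; first by rewrite ltn_divLR.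
exists s2; have := frob_step_trans alpha_neq0 h1 h2.
by rewrite add1n expn1 -PoszM -PoszD addnC mulnC -divn_eq.
Qed.

(** Infinitely many levels but finitely many spaces: one target of full rank occurs at two levels,
    and [frob_step_same] yields the period. *)
Lemma full_rank_period s :
  (forall N, exists2 r : nat, (r < p ^ N)%N &
     forall s', frob_step N r (W s) (W s') -> \rank (W s') = \rank (W s)) ->
  exists f u, (0 < f)%N /\ frob_period f u (W s).
Proof.
move=> h; have /choice[g gP] : forall N, exists x : nat * T,
    frob_step N x.1 (W s) (W x.2) /\ \rank (W x.2) = \rank (W s).
  move=> N; have [r rlt rk] := h N; have [s' hs'] := multi_step s rlt.
  by exists (r, s'); split=> //; apply: rk.
have [M [N [MN e]]] := pigeonhole (fun N => (g N).2).
have [h1 rk] := gP M; have [h2 _] := gP N; rewrite -e in h2.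
have := frob_step_same alpha_neq0 (ltnW MN) h1 h2 rk.
set u := _ - _ => per; exists (N - M)%N, u; split=> //.
by rewrite subn_gt0.
Qed.

(** Otherwise each level has a residue not congruent to [u] that keeps the rank, and two levels
    share their target. Comparing the resulting period with the iterated one gives a stabilizing
    shift, which is 0; this makes the later residue congruent to [u]. *)
Lemma rank_drop s f u n0 : (0 < f)%N -> frob_period f u (W s) ->
  zeros (W s) n0 -> (\rank (W s) < d)%N ->
  exists2 k, (0 < k)%N & forall t : nat, (t < p ^ (f * k))%N ->
    ~~ ((p ^ f)%N%:Z %| t%:Z - u)%Z -> exists2 s', frob_step (f * k) t (W s) (W s') & (\rank (W s') < \rank (W s))%N.
Proof.
move=> f0 per z0 rkd; apply: contrapT => h.
have /choice[g gP] : forall k, exists x : nat * T,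
    [/\ ~~ ((p ^ f)%N%:Z %| x.1%:Z - u)%Z, frob_step (f * k.+1) x.1 (W s) (W x.2)
      & \rank (W x.2) = \rank (W s)].
  move=> k; apply: contrapT => hk; apply: h; exists k.+1 => // t tlt tu.
  have [s' hs'] := multi_step s tlt; exists s' => //.
  rewrite ltn_neqAle (frob_step_rank hs') andbT; apply/negP => /eqP e.
  by apply: hk; exists (t, s').
have [i [j [ij e]]] := pigeonhole (fun k => (g k).2).
have [_ h1 rk] := gP i; have [nd h2 _] := gP j; rewrite -e in h2.
have := frob_step_same alpha_neq0 (leq_mul (leqnn f) (ltnW ij : (i < j.+1)%N)) h1 h2 rk.
rewrite -mulnBr subSS; set l := (j - i)%N; set x := _ - _ => e1.
have e2 := eqmx_trans (eqmx_sym (frob_period_iter l per)) e1.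
have := eqmxMr (adiag x) e2; rewrite mul_adiagNK // mul_adiagA // => /eqmxP/andP[h3 _].
have /eqP := adiag_stable_eq0 alpha_neq0 alpha_indep z0 rkd h3.
rewrite addrC subr_eq0 => /eqP e3; move: nd; rewrite -(subrK ((p ^ (f * l))%N%:Z * (g i).1%:Z) (g j).1%:Z) -/x e3.
have -> : l = l.-1.+1 by rewrite prednK // subn_gt0.
apply/negP; rewrite negbK; apply/dvdzP.
exists (geom (p ^ f)%N%:Z u l.-1 + (p ^ (f * l.-1))%N%:Z * (g i).1%:Z).
by rewrite geomS mulnS expnD PoszM; ring.
Qed.

Lemma common_base (P : T -> Prop) (w : T -> nat) (Z : T -> int -> Prop) :
  (forall s, P s -> exists2 f, (0 < f)%N & nested (p ^ f) (w s) (Z s)) ->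
  exists2 f, (0 < f)%N & forall s, P s -> nested (p ^ f) (w s) (Z s).
Proof.
move=> h; have /choice[g gP] : forall s, exists f, (0 < f)%N /\ (P s -> nested (p ^ f) (w s) (Z s)).
  move=> s; have [/h[f f0 hf]|nP] := pselect (P s); first by exists f.
  by exists 1%N.
exists (\prod_s g s)%N; first by rewrite prodn_gt0 // => s; case: (gP s).
move=> s Ps; rewrite (bigD1 s) //= expnM; apply: nested_refine.
- by rewrite expn_gt0 (ltnW p_gt1).
- by rewrite prodn_gt0 // => s'; case: (gP s').
- exact: (gP s).2 Ps.
Qed.

Lemma zeros_nested s : (\rank (W s) < d)%N ->
  exists2 f, (0 < f)%N & nested (p ^ f) (\rank (W s)) (zeros (W s)).
Proof.
have [w] := ubnP (\rank (W s)); elim: w s => // w IH s; rewrite ltnS => rkw rkd.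
have [f' f'0 hf'] : exists2 f, (0 < f)%N & forall s', (\rank (W s') < \rank (W s))%N ->
    nested (p ^ f) (\rank (W s')) (zeros (W s')).
  apply: common_base => s' lt; apply: IH; first exact: leq_trans lt rkw.
  exact: ltn_trans lt rkd.
have [[n0 z0]|nz] := pselect (exists n, zeros (W s) n); last first.
  by exists 1%N => //; apply: nested0 => n zn; apply: nz; exists n.
have p0 N : (0 < p ^ N)%N by rewrite expn_gt0 (ltnW p_gt1).
have modE N (n : int) : exists2 r : nat, (r < p ^ N)%N & ((p ^ N)%N%:Z %| n - r%:Z)%Z.
  have pN0 : (p ^ N)%N%:Z != 0 :> int by rewrite -lt0n.
  exists `|(n %% (p ^ N)%N)%Z|%N.
    rewrite -ltz_nat gez0_abs ?modz_ge0 //; apply: ltz_pmod; rewrite ltz_nat; exact: p0.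
  by rewrite gez0_abs ?modz_ge0 // -eqz_mod_dvd modz_mod.
(* Either all residues at some level lower the rank, or every level has a residue that preserves
   it. *)
have [[N hN]|hN] := pselect (exists N, forall r : nat, (r < p ^ N)%N ->
   exists2 s', frob_step N r (W s) (W s') & (\rank (W s') < \rank (W s))%N).
  exists f' => //; have /choice[g gP] : forall r : nat, exists s', (r < p ^ N)%N ->
    frob_step N r (W s) (W s') /\ (\rank (W s') < \rank (W s))%N.
    move=> r; have [/hN[s' h1 h2]|le] := ltnP r (p ^ N)%N; first by exists s'.
    by exists s.
  apply: (@nested_ext _ _ (fun n => exists2 r, r \in iota 0 (p ^ N) &
     exists2 m, zeros (W (g r)) m & n = (p ^ N)%N%:Z * m + r%:Z)).
    move=> n; split=> [[r]|zn].
      rewrite mem_iota => /andP[_ /gP[[h _] _]] [m zm ->].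
      by rewrite -h.
    have [r rlt rd] := modE N n; exists r; first by rewrite mem_iota.
    exact: zeros_affine (gP r rlt).1 _ rd zn.
  apply: nested_bigU => r; rewrite mem_iota => /andP[_ /gP[_ lt]].
  by apply: nested_affine => //; apply: nested_le (ltnW lt) _; apply: hf'.
have [|f1 [u1 [f10 per1]]] := @full_rank_period s.
  move=> N; apply: contrapT => h; apply: hN; exists N => r rlt.
  apply: contrapT => h2; apply: h; exists r => // s' hs'.
  apply/eqP; rewrite eqn_leq (frob_step_rank hs') leqNgt.
  by apply/negP => lt; apply: h2; exists s'.
(* Iterating [f'] times makes the period base a power of the base used for the smaller spaces. *)
have per := frob_period_iter f' per1; set u := geom _ _ _ in per.
set f := (f1 * f')%N in per.
have f0 : (0 < f)%N by rewrite muln_gt0 f10.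
have [k k0 hk] := rank_drop f0 per z0 rkd; exists f => //.
set q := (p ^ f)%N.
pose ts := [seq t <- iota 0 (p ^ (f * k)) | ~~ (q%:Z %| t%:Z - u)%Z].
have nestq s' : (\rank (W s') < \rank (W s))%N -> nested q (\rank (W s')) (zeros (W s')).
  by move=> lt; rewrite /q /f mulnC expnM; apply: nested_refine => //; apply: hf'.
(* For each residue [t] in [ts], its zeros come from a smaller space, and [X t] is their saturation;
   this costs one coefficient, paid for by the drop in rank. *)
have /choice[X XP] : forall t : nat, exists X : int -> Prop, t \in ts ->
    [/\ nested q (\rank (W s)) X, forall n, X n -> zeros (W s) n &
      forall n j, zeros (W s) n -> ((p ^ (f * k))%N%:Z %| n - t%:Z)%Z ->
        X (q%:Z ^+ j * n + geom q%:Z u j)].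
  move=> t; have [|] := boolP (t \in ts); last by exists (fun=> True).
  rewrite mem_filter mem_iota => /andP[nd tlt]; have [s' hs' lt] := hk t tlt nd.
  have nY := nested_affine (p ^ (f * k))%N%:Z t%:Z (p0 f) (nestq _ lt).
  have [|Y [h1 h2 h3]] := nested_saturate f0 per nY.
    by move=> n [m zm ->]; rewrite -hs'.1.
  exists Y => _; split=> //; first exact: nested_le lt h1.
  by move=> n j zn nd'; apply: h3; apply: zeros_affine hs' _ nd' zn.
pose F (n : int) := (q%:Z - 1) * n + u = 0 /\ zeros (W s) n.
(* Needed for the singleton of the fixed point: [W s] contains the nonzero vector [apow n0]. *)
have rk0 : (0 < \rank (W s))%N.
  case: (posnP d) => [e|d0]; first by move: rkd; rewrite [X in (_ < X)%N]e.
  rewrite lt0n mxrank_eq0; apply: contraTneq z0 => ->; rewrite submx0.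
  apply/eqP => /rowP/(_ (Ordinal d0)); rewrite !mxE => /eqP.
  by rewrite expfz_eq0 (negPf (alpha_neq0 _)) andbF.
have q1 : (1 < q)%N by rewrite /q -[X in (X < _)%N](exp1n f) ltn_exp2r.
have nF : nested q (\rank (W s)) F.
  have [[n1 [e1 z1]]|nF] := pselect (exists n, F n); last first.
    by apply: nested0 => n Fn; apply: nF; exists n.
  apply: (@nested_ext _ _ (fun n => n = n1)); last exact: nested1.
  move=> n; split=> [->//|[e2 _]].
  have /mulfI : q%:Z - 1 != 0 by rewrite subr_eq0; apply/eqP => -[]; move: q1; case: (q) => [|[]].
  by apply; apply: (addIr u); rewrite e1 e2.
apply: (@nested_ext _ _ (fun n => F n \/ exists2 t, t \in ts & X t n)).
  move=> n; split=> [[[]//|[t /XP[_ h _] /h //]]|zn].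
  have [e|[j [n1 [e nd]]]] := @affine_orbit q%:Z u n q1; first by left.
  right; have [t tlt td] := modE (f * k)%N n1.
  have zn1 : zeros (W s) n1 by rewrite -(frob_period_orbit n1 j per) -e.
  have tts : t \in ts.
    rewrite mem_filter mem_iota tlt !andbT; apply: contra nd => td'.
    rewrite -(subrK t%:Z n1) -addrA; apply: rpredD => //.
    apply: dvdz_trans td; rewrite /q dvdzE /= dvdn_exp2l //.
    by rewrite leq_pmulr.
  by exists t => //; rewrite e; have [_ _ h] := XP t tts; apply: h.
apply: nestedU => //; apply: nested_bigU => t /XP[h _ _]; exact: h.
Qed.
End States.
End ZeroSets.

(** * Finiteness of the set of subspaces *)

Section FiniteStates.
Variables (L : fieldType) (p : nat) (charp : p \in [pchar L]).
Variables (E : L -> Prop) (I : finType) (b : I -> L).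
Hypothesis splitE : frob_split p E b.
Variables (d : nat) (alpha gamma : 'I_d -> L).
Hypotheses (alpha_neq0 : forall i, alpha i != 0).
Hypotheses (Ealpha : forall i, E (alpha i)) (Egamma : forall i, E (gamma i)).

(** A state is a set of equations with coefficients in the finite group [M]. A Frobenius step
    replaces each equation by those obtained from the p-th roots of its twisted coefficients'
    coordinates, which stay in [M]. *)
Lemma finite_states : exists (T : finType) (W : T -> 'M[L]_d) (s0 : T),
  (forall s (r : nat), (r < p)%N -> exists s', frob_step charp alpha 1 r (W s) (W s')) /\
  (forall x : 'rV_d, (x <= W s0)%MS = (\sum_i x 0 i * gamma i == 0)).
Proof.
have [HE Eb freeb stable] := splitE.
have Eapow i (m : int) : E (alpha i ^ m).
  case: m => m; first exact: (sfX HE).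
  by rewrite NegzE -exprnN; apply/(sfV HE)/(sfX HE).
pose S := [seq alpha i ^+ r | i <- enum 'I_d, r <- iota 0 p] ++ [seq gamma i | i : 'I_d].
have [|M [[l hl] add sub inS rep]] := stable S.
  move=> x; rewrite mem_cat => /orP[/allpairsP[[i r] [_ _ ->]]|/imageP[i _ ->]] //.
  exact: (sfX HE).
pose l' := [seq x <- l | `[< M x >]].
have Ml' x : M x <-> x \in l'.
  rewrite mem_filter; split=> [Mx|/andP[/asboolP]//].
  by rewrite (asboolT Mx) hl.
pose V : finType := {ffun 'I_d -> 'I_(size l')}.
pose vec (v : V) (i : 'I_d) : L := nth 0 l' (v i).
have vecM v i : M (vec v i) by apply/Ml'/mem_nth.
have Mvec (x : 'I_d -> L) : (forall i, M (x i)) -> exists v, forall i, vec v i = x i.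
  move=> hx; have lt i : (index (x i) l' < size l')%N by rewrite index_mem; apply/Ml'.
  by exists [ffun i => Ordinal (lt i)] => i; rewrite /vec ffunE nth_index //; apply/Ml'.
pose W (s : {set V}) : 'M[L]_d := (\bigcap_(v in s) kermx (\col_i vec v i))%MS.
have WP m (A : 'M_(m, d)) (s : {set V}) : reflect (forall v, v \in s -> forall k, \sum_i A k i * vec v i = 0)
    (A <= W s)%MS.
  apply: (iffP sub_bigcapmxP) => h v vs.
    move=> k; have /sub_kermxP/matrixP/(_ k 0) := h v vs; rewrite !mxE => e.
    by rewrite -[RHS]e; apply: eq_bigr => i _; rewrite !mxE.
  apply/sub_kermxP/matrixP => k j; rewrite !mxE -[RHS](h v vs k).
  by apply: eq_bigr => i _; rewrite !mxE.
have gS i : gamma i \in S.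
  by rewrite mem_cat; apply/orP; right; apply/imageP; exists i.
have [v0 v0E] := Mvec gamma (fun i => inS _ (gS i)).
exists {set V}, W, [set v0]; split; last first.
  move=> x; apply/WP/eqP => [/(_ v0 (set11 _) 0) e|e v /set1P-> k].
    by rewrite -[RHS]e; apply: eq_bigr => i _; rewrite v0E.
  by rewrite (ord1 k) -[RHS]e; apply: eq_bigr => i _; rewrite v0E.
move=> s r rlt.
have aS i : alpha i ^+ r \in S.
  rewrite mem_cat; apply/orP; left.
  by apply/allpairsP; exists (i, r); rewrite mem_enum mem_iota.
have /choice[c cE] (vi : V * 'I_d) : exists c : I -> L,
    (forall e, M (c e)) /\ alpha vi.2 ^+ r * vec vi.1 vi.2 = \sum_e c e ^+ p * b e.
  by have [c ? ?] := rep _ _ (aS vi.2) (vecM vi.1 vi.2); exists c.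
have /choice[g gE] (ve : V * I) : exists v, forall i, vec v i = c (ve.1, i) ve.2.
  by apply: Mvec => i; case: (cE (ve.1, i)).
(* The twisted equation [v] at the p-th powers of [x] is the combination of the p-th powers of the
   new equations [g (v, e)] at [x]. *)
have key v (x : 'I_d -> L) : \sum_i x i ^+ p * alpha i ^+ r * vec v i =
    \sum_e (\sum_i x i * vec (g (v, e)) i) ^+ p * b e.
  under [RHS]eq_bigr => e _ do rewrite (exprp_sum charp) mulr_suml.
  rewrite exchange_big; apply: eq_bigr => i _ /=; rewrite -mulrA (cE (v, i)).2 mulr_sumr.
  by apply: eq_bigr => e _; rewrite gE exprMn mulrA.
exists [set g ve | ve in setX s [set: I]]; split.
  move=> m; apply/WP/WP => h v.
    move=> vs k; rewrite -[RHS](_ : \sum_(e : I) 0 = 0); last by rewrite big1.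
    rewrite -[LHS](_ : \sum_i (alpha i ^ m) ^+ p * alpha i ^+ r * vec v i = _).
      rewrite key; apply: eq_bigr => e _; rewrite -[X in X ^+ p](_ : 0 = _) ?expr0n.
        by rewrite eqn0Ngt (prime_gt0 (pcharf_prime charp)) mul0r.
      rewrite -[LHS](h (g (v, e)) _ 0); last by apply: imset_f; rewrite !inE vs.
      by apply: eq_bigr => i _; rewrite !mxE.
    apply: eq_bigr => i _; rewrite !mxE expn1 expfzDr // !exprnP; congr (_ * _ * _).
    by rewrite exprz_exp mulrC.
  move=> /imsetP[[v' e] /setXP[vs _] ->] k.
  have hv := h v' vs k; apply: etrans (freeb (fun e => \sum_i alpha i ^ m * vec (g (v', e)) i) _ _ e).
  - by apply: eq_bigr => i _; rewrite !mxE.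
  - by move=> e'; apply: (sf_sum HE) => i _; apply: (sfM HE); last exact/sub/vecM.
  rewrite -key -[RHS]hv; apply: eq_bigr => i _; rewrite !mxE expn1 expfzDr // !exprnP.
  by rewrite exprz_exp [m * _]mulrC.
(* For arbitrary rows over [L], vanishing of the new equations gives vanishing of the old one by
   [key]; the equivalence above is for points [apow m], whose entries lie in [E]. *)
rewrite -(submx_adiag alpha_neq0 r%:Z) mul_adiagNK //; apply/WP => v vs k.
set A := W _; have hA := elimT (WP _ A _) (submx_refl _).
rewrite -[RHS](_ : \sum_(e : I) 0 = 0); last by rewrite big1.
rewrite -[LHS](_ : \sum_i (A k i) ^+ p * alpha i ^+ r * vec v i = _).
  rewrite key; apply: eq_bigr => e _; rewrite hA; last by apply: imset_f; rewrite !inE vs.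
  by rewrite expr0n eqn0Ngt (prime_gt0 (pcharf_prime charp)) mul0r.
by apply: eq_bigr => i _; rewrite mul_mx_diag !mxE /frob expn1.
Qed.
End FiniteStates.

(** * Power sum representation *)

(** A divisor of least size above 1 is irreducible. *)
Lemma irreducible_factor (K : fieldType) (P : {poly K}) : (1 < size P)%N ->
  exists2 r, irreducible_poly r & r %| P.
Proof.
move=> szP; pose D n := `[< exists2 r : {poly K}, (1 < size r)%N /\ r %| P & size r = n >].
have ex : exists n, D n by exists (size P); apply/asboolP; exists P; rewrite ?dvdpp.
case: (ex_minnP ex) => n /asboolP[r [r1 rP] <-] minn; exists r => //; split=> // q q1 qr.
rewrite -dvdp_size_eqp // eqn_leq dvdp_leq -?size_poly_gt0 ?(ltnW r1) //=.
apply: minn; apply/asboolP; exists q => //; split; last exact: dvdp_trans rP.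
have q0 : q != 0 by apply: contraTneq qr => ->; rewrite dvd0p -size_poly_gt0 ltnW.
by move: q0 q1; rewrite -size_poly_gt0; case: (size q) => [|[]].
Qed.

Lemma splitting_field (K : fieldType) (P : {poly K}) : P != 0 ->
  exists (L : fieldType) (f : {rmorphism K -> L}) (rs : seq L),
    map_poly f P %= \prod_(z <- rs) ('X - z%:P).
Proof.
have [n] := ubnP (size P); elim: n K P => // n IH K P; rewrite ltnS => szP P0.
have [le1|gt1] := leqP (size P) 1.
  exists K, (idfun : {rmorphism K -> K}), [::]; rewrite big_nil map_poly_id // -size_poly_eq1.
  by rewrite eqn_leq le1 size_poly_gt0.
have [r irr_r rP] := irreducible_factor gt1.
have [L1 _ [z rz _]] := irredp_FAdjoin irr_r.
have Pz : root (map_poly (in_alg L1) P) z.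
  by rewrite -(divpK rP) rmorphM rootM rz orbT.
have [q Pq] := factor_theorem _ _ Pz.
have q0 : q != 0.
  apply: contraNneq P0 => e; move: Pq; rewrite e mul0r => /eqP.
  by rewrite map_poly_eq0.
have szq : (size q < n)%N.
  move: szP; rewrite -(size_map_poly (in_alg L1)) Pq size_mul ?polyXsubC_eq0 // size_XsubC.
  by rewrite addn2.
have [L [f [rs e]]] := IH L1 q szq q0.
exists L, (f \o in_alg L1 : {rmorphism K -> L}), (f z :: rs).
rewrite big_cons mulrC map_poly_comp Pq rmorphM /= map_polyXsubC.
exact: eqp_mulr.
Qed.

Section PowerSums.
Variables (K L : fieldType) (f : {rmorphism K -> L}) (a : nat -> K) (P : {poly K}) (d : nat).
Variable (alpha : 'I_d -> L).
Hypotheses (monP : P \is monic) (annP : annihilates P a) (szP : size P = d.+1).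
Hypotheses (rootP : forall i, root (map_poly f P) (alpha i)) (alpha_inj : injective alpha).

(** The [gamma] solve the Vandermonde system for the first [d] terms; beyond them both sides satisfy
    the recurrence of [P]. *)
Lemma recurrence_power_sum :
  exists gamma : 'I_d -> L, forall n, f (a n) = \sum_i gamma i * alpha i ^+ n.
Proof.
pose V := Vandermonde d (\row_i alpha i).
have uV : V \in unitmx.
  rewrite unitmxE det_Vandermonde unitfE.
  apply/prodf_neq0 => i _; apply/prodf_neq0 => j ij; rewrite subr_eq0 !mxE.
  by rewrite (inj_eq alpha_inj) eq_sym neq_ltn ij.
pose g : 'cV_d := invmx V *m \col_(k < d) f (a k); exists (fun i => g i 0).
have lead (x : L) : root (map_poly f P) x -> x ^+ d = - \sum_(j < d) f P`_j * x ^+ j.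
  rewrite /root horner_coef size_map_poly szP big_ord_recr /= !coef_map /=.
  have -> : P`_d = 1 by move: (monicP monP); rewrite lead_coefE szP.
  rewrite rmorph1 mul1r addrC addr_eq0 => /eqP->; congr (- _).
  by apply: eq_bigr => j _; rewrite coef_map.
have recL n : f (a (n + d)%N) = - \sum_(j < d) f P`_j * f (a (n + j)%N).
  have := annP n; rewrite szP big_ord_recr /=.
  have -> : P`_d = 1 by move: (monicP monP); rewrite lead_coefE szP.
  rewrite mul1r addrC => /eqP; rewrite addr_eq0 => /eqP->.
  by rewrite rmorphN rmorph_sum; congr (- _); apply: eq_bigr => j _; rewrite rmorphM.
move=> n; have [m] := ubnP n; elim: m n => // m IH n; rewrite ltnS => le.
have [lt|ge] := ltnP n d.
  have : (V *m g) (Ordinal lt) 0 = f (a n) by rewrite mulKVmx // !mxE.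
  by move=> <-; rewrite mxE; apply: eq_bigr => i _; rewrite !mxE mulrC.
rewrite -(subnK ge) recL; under [RHS]eq_bigr => i _ do rewrite exprD (lead _ (rootP i)) mulrN mulrN.
rewrite sumrN; congr (- _).
under [RHS]eq_bigr => i _ do rewrite mulr_sumr mulr_sumr.
rewrite exchange_big; apply: eq_bigr => j _ /=; rewrite IH; last first.
  by apply: leq_trans le; rewrite -{2}(subnK ge) ltn_add2l.
by rewrite mulr_sumr; apply: eq_bigr => i _; rewrite exprD; ring.
Qed.
End PowerSums.

(** * The zero set *)

Lemma uniq_roots_simple (L : fieldType) (rs : seq L) :
  (forall x, ~~ (('X - x%:P) ^+ 2 %| \prod_(z <- rs) ('X - z%:P))) -> uniq rs.
Proof.
elim: rs => //= z rs IH h; apply/andP; split.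
  apply/negP => zrs; have := h z; rewrite big_cons expr2 dvdp_mul //.
  by rewrite dvdp_XsubCl root_prod_XsubC.
apply: IH => x; apply: contra (h x) => dv; rewrite big_cons.
exact: dvdp_mull.
Qed.

Lemma simple_split (K L : fieldType) (f : {rmorphism K -> L}) (P : {poly K}) :
  P \is monic -> simple_poly P ->
  forall rs, map_poly f P %= \prod_(z <- rs) ('X - z%:P) ->
  [/\ uniq rs, size P = (size rs).+1 & forall z, z \in rs -> root (map_poly f P) z].
Proof.
move=> monP simP rs e.
have mP : map_poly f P = \prod_(z <- rs) ('X - z%:P).
  by apply/eqP; rewrite -eqp_monic ?monic_map ?monic_prod_XsubC.
split; last by move=> z zrs; rewrite mP root_prod_XsubC.
- by apply: uniq_roots_simple => x; rewrite -mP; apply: simP.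
- by rewrite -(size_map_poly f) mP size_prod_XsubC.
Qed.

(** Raising everything to the power [p ^ k] is injective and keeps the zeros, while moving the data
    into the field [E] of the tower. A nonzero [gamma i0] makes the space a proper one. *)
Lemma power_sum_zeros_nested (L : fieldType) (p d : nat) (alpha gamma : 'I_d -> L) :
  p \in [pchar L] -> (forall i, alpha i != 0) ->
  (forall i j n, i != j -> (0 < n)%N -> (alpha i / alpha j) ^+ n != 1) ->
  (exists i, gamma i != 0) ->
  p_nested p (d - 2)%N (fun n => \sum_i gamma i * alpha i ^+ n = 0).
Proof.
move=> charp a0 aind [i0 gi0].
have p1 := prime_gt1 (pcharf_prime charp).
have [E [I [b [k [splitE hE]]]]] :=
  frob_split_tower charp ([seq alpha i | i : 'I_d] ++ [seq gamma i | i : 'I_d]).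
pose al i := alpha i ^+ (p ^ k); pose ga i := gamma i ^+ (p ^ k).
have al0 i : al i != 0 by rewrite expf_neq0.
have Eal i : E (al i) by apply: hE; rewrite mem_cat; apply/orP; left; apply/imageP; exists i.
have Ega i : E (ga i) by apply: hE; rewrite mem_cat; apply/orP; right; apply/imageP; exists i.
have alind i j n : i != j -> (0 < n)%N -> (al i / al j) ^+ n != 1.
  move=> ij n0; rewrite /al -exprVn -exprMn -exprM; apply: aind => //.
  by rewrite muln_gt0 n0 expn_gt0 (ltnW p1).
have [T [W [s0 [step W0]]]] := finite_states charp splitE al0 Eal Ega.
have rk : (\rank (W s0) < d)%N.
  rewrite ltn_neqAle rank_leq_col andbT; apply: contra gi0 => full.
  have : ((delta_mx 0 i0 : 'rV[L]_d) <= W s0)%MS by apply: submx_full.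
  rewrite W0 (bigD1 i0) //= big1 => [|i ii0]; last by rewrite mxE (negPf ii0) andbF mul0r.
  by rewrite mxE !eqxx mul1r addr0 expf_eq0 => /andP[].
have [f f0 nest] := zeros_nested al0 alind step rk.
have d0 : (0 < d)%N by apply: leq_ltn_trans rk.
have : p_nested p (d - 2)%N (fun n : nat => (apow al n <= W s0)%MS).
  have le : (\rank (W s0) <= d.-1)%N by rewrite -ltnS prednK.
  (* One unit comes from the hyperplane, the other from the strict bound in [nested]. *)
  rewrite (_ : d - 2 = d.-1.-1)%N; first exact: nested_p_nested p1 f0 (nested_le le nest).
  by rewrite -!subn1 -subnDA.
move=> [F [G [h1 h2]]]; exists F, G; split=> // n; rewrite -h2 W0.
have -> : \sum_i apow al n 0 i * ga i = frob charp k (\sum_i gamma i * alpha i ^+ n).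
  rewrite raddf_sum; apply: eq_bigr => i _; rewrite mxE /al /ga -exprnP.
  by rewrite [RHS]exprMn mulrC -!exprM [(n * _)%N]mulnC.
by rewrite /frob expf_eq0 expn_gt0 (ltnW p1) /=; split=> [->|/eqP].
Qed.

Lemma p_nested_ext p k (S S' : nat -> Prop) : (forall n, S n <-> S' n) ->
  p_nested p k S -> p_nested p k S'.
Proof. by move=> e [F [G [h1 h2]]]; exists F, G; split=> // n; rewrite -e. Qed.

Theorem theorem2p7 (K : fieldType) (p : nat) (a : nat -> K) (P : {poly K}) (d : nat) :
  p \in [pchar K] ->
  (exists n : nat, a n != 0) ->
  is_minpoly a P ->
  simple_poly P ->
  nondegenerate_poly P ->
  d = (size P).-1 ->
  p_nested p (d - 2)%N (zero_set a).
Proof.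
move=> charK [n0 an0] [monP annP _] simP ndP dE.
have [L [f [rs prs]]] := splitting_field (monic_neq0 monP).
have [urs szP rts] := simple_split monP simP prs.
have szd : d = size rs by rewrite dE szP.
pose alpha (i : 'I_d) := rs`_i.
have ars i : alpha i \in rs by rewrite mem_nth // -szd.
have rta i : root (map_poly f P) (alpha i) by apply: rts.
have alpha_inj : injective alpha.
  by move=> i j /eqP; rewrite nth_uniq -?szd // => /eqP/val_inj.
have [|gamma ga] := recurrence_power_sum monP annP _ rta alpha_inj.
  by rewrite szP -szd.
apply: (@p_nested_ext _ _ (fun n => \sum_i gamma i * alpha i ^+ n = 0)).
  move=> n; rewrite -ga /zero_set; split=> [/eqP|->]; last exact: rmorph0.
  by rewrite fmorph_eq0 => /eqP.
apply: power_sum_zeros_nested.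
- by rewrite (fmorph_pchar f).
- by move=> i; case: (ndP L f _ _ (rta i) (rta i)).
- move=> i j n ij n0'; apply/eqP => e; case: (ndP L f _ _ (rta i) (rta j)) => _.
  by rewrite (inj_eq alpha_inj) => /(_ ij); apply; exists n.
(* If every [gamma i] were 0, the sequence would vanish, against [an0]. *)
- apply: contrapT => ng; move: an0; rewrite -(fmorph_eq0 f) ga big1 ?eqxx // => i _.
  have [->|gi] := eqVneq (gamma i) 0; first by rewrite mul0r.
  by case: ng; exists i.
Qed.
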